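(* Assume that there are constants $\pi\ge1$, $C_{V,\lambda}\ge1$, $c_\lambda>0$ such that: (i) for all $t\ge t'\ge t_\circ$, the sequence $\Big(\frac{1-\gamma_i^{(t')}}{1-\gamma_i^{(t)}}\Big)_{i=1,\dots,D}$ with values in $[0,\infty]$ is nonincreasing in $i$; (ii) for all $i'\le i$ and $t\ge t_\circ$: $\gamma_i^{(t)}\le\gamma_{i'}^{(t)}$; (iii) for all $t\ge t'\ge t_\circ$: $V_t\le C_{V,\lambda}(V_{t,\lambda}/V_{t',\lambda})^\pi V_{t'}$; (iv) for every $k=1,\dots,D$: $\frac1k\sum_{i=1}^k\lambda_i^{-2}\ge c_\lambda^2\lambda_k^{-2}$. Assume further that there exist $\nu_-,\nu_+>0$ and an integer $2\le L\le D$ such that for all $L\le k\le D$ $$0<L^{-1/\nu_-}\le\frac{\lambda_k}{\lambda_{\lceil k/L\rceil}}\quad\text{and}\quad\frac{\lambda_k}{\lambda_{\lfloor k/L\rfloor}}\le L^{-1/\nu_+}<1,$$ and that for some $C_1,C_2>0$ $$C_1\mathbf 1(t^\ast>t_\circ)V_{t_\circ,\lambda}\le B_{t^\ast,\lambda}^2(\mu)\le C_2\sup_{t>0}V_{t,\lambda}.$$ Then $$\mathbb{E}\big[\|\widehat\mu^{(\tau)}-\mu\|^2\big]\le C_{\tau,t^\ast}\,\mathbb{E}\big[\|\widehat\mu^{(t^\ast)}-\mu\|^2\big]$$ for a constant $C_{\tau,t^\ast}$ depending only on $C_\circ,C_1,C_2,c_\lambda,\pi,C_{V,\lambda},\nu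_-,L$.
   Context: Fix $D\in\mathbb{N}$, a noise level $\delta>0$, numbers $1\ge\lambda_1\ge\dots\ge\lambda_D>0$ and a signal $\mu\in\mathbb{R}^D$. One observes $Y_i=\lambda_i\mu_i+\delta\varepsilon_i$, $i=1,\dots,D$, with $\varepsilon_i$ independent standard normal. Filters: for each $i$, $t\mapsto\gamma_i^{(t)}\in[0,1]$, $t\ge0$, is continuous and nondecreasing with $\gamma_i^{(0)}=0$ and $\gamma_i^{(t)}\uparrow1$ as $t\to\infty$. Estimators: $\widehat\mu_i^{(t)}=\gamma_i^{(t)}\lambda_i^{-1}Y_i$. $\|\cdot\|$ is the Euclidean norm on $\mathbb{R}^D$. Notation: $R_t^2=\sum_i(1-\gamma_i^{(t)})^2Y_i^2$; $V_t=\delta^2\sum_i(\gamma_i^{(t)})^2\lambda_i^{-2}$; $V_{t,\lambda}=\delta^2\sum_i(\gamma_i^{(t)})^2$; $B_{t,\lambda}^2(\mu)=\sum_i(1-\gamma_i^{(t)})^2\lambda_i^2\mu_i^2$. Initial step: $t_\circ=\inf\{t\ge0:V_{t,\lambda}=C_\circ D^{1/2}\delta^2\}$ for a constant $C_\circ\ge1$ with $C_\circ<D^{1/2}$. For a threshold $\kappa>0$: $\tau=\inf\{t\ge t_\circ:R_t^2\le\kappa\}$ and $t^\ast=\inf\{t\ge t_\circ:\mathbb{E}[R_t^2]\le\kappa\}$. Convention: in the ratio in (i), $c/0=+\infty$ for every $c\ge0$. *)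

(* Defs.v *)
(* Vectors of R^D are functions 'I_D -> R; since ordinals start at 0, the
   ordinal i stands for the (i+1)-st coordinate, i.e. for the index i.+1 of
   {1, ..., D}. *)
From mathcomp Require Import all_boot all_order all_algebra.
From mathcomp Require Import all_classical all_reals all_analysis.
Set Implicit Arguments.
Unset Strict Implicit.
Unset Printing Implicit Defensive.
Import Order.TTheory GRing.Theory Num.Theory.
Import numFieldNormedType.Exports.
Local Open Scope classical_set_scope.
Local Open Scope ring_scope.

Definition enorm (R : realType) (D : nat) (x : 'I_D -> R) : R :=
  Num.sqrt (\sum_(i < D) x i ^+ 2).

Definition ceil_divn (m d : nat) : nat := (m %/ d + ~~ (d %| m))%N.

Definition is_filter (R : realType) (g : R -> R) : Prop :=
  [/\ forall t, 0 <= t -> 0 <= g t <= 1,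
      {within `[0, +oo[, continuous g},
      forall s t, 0 <= s -> s <= t -> g s <= g t,
      g 0 = 0
    & g t @[t --> +oo] --> (1 : R)].

(* (1 - g') / (1 - g) in [0, +oo], with c / 0 = +oo for every c >= 0
   (including c = 0). *)
Definition filter_ratio (R : realType) (g' g : R) : \bar R :=
  if 1 - g == 0 then +oo%E else ((1 - g') / (1 - g))%:E.

Definition observation (R : realType) (D : nat) (delta : R)
    (lambda mu eps : 'I_D -> R) : 'I_D -> R :=
  fun i => lambda i * mu i + delta * eps i.

Definition estimator (R : realType) (D : nat) (gamma : 'I_D -> R -> R)
    (lambda : 'I_D -> R) (t : R) (y : 'I_D -> R) : 'I_D -> R :=
  fun i => gamma i t * (lambda i)^-1 * y i.

Definition residual2 (R : realType) (D : nat) (gamma : 'I_D -> R -> R)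
    (t : R) (y : 'I_D -> R) : R :=
  \sum_(i < D) (1 - gamma i t) ^+ 2 * y i ^+ 2.

Definition var (R : realType) (D : nat) (delta : R) (gamma : 'I_D -> R -> R)
    (lambda : 'I_D -> R) (t : R) : R :=
  delta ^+ 2 * \sum_(i < D) gamma i t ^+ 2 * lambda i ^- 2.

Definition weak_var (R : realType) (D : nat) (delta : R)
    (gamma : 'I_D -> R -> R) (t : R) : R :=
  delta ^+ 2 * \sum_(i < D) gamma i t ^+ 2.

Definition weak_bias2 (R : realType) (D : nat) (gamma : 'I_D -> R -> R)
    (lambda mu : 'I_D -> R) (t : R) : R :=
  \sum_(i < D) (1 - gamma i t) ^+ 2 * lambda i ^+ 2 * mu i ^+ 2.

(* In the three definitions below, [inf] is the infimum of a set of reals (with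
   inf set0 = 0).  When 1 <= Ccirc < sqrt D, 0 < delta and 0 < kappa, the sets
   are nonempty, by continuity of the filters and their convergence to 1. *)
Definition tcirc (R : realType) (D : nat) (delta : R)
    (gamma : 'I_D -> R -> R) (Ccirc : R) : R :=
  inf [set t | 0 <= t /\
    weak_var delta gamma t = Ccirc * Num.sqrt D%:R * delta ^+ 2].

Definition tau (R : realType) (D : nat) (gamma : 'I_D -> R -> R)
    (t0 kappa : R) (y : 'I_D -> R) : R :=
  inf [set t | t0 <= t /\ residual2 gamma t y <= kappa].

Definition tstar (R : realType) (d : measure_display) (T : measurableType d)
    (P : probability T R) (D : nat) (gamma : 'I_D -> R -> R)
    (t0 kappa : R) (Y : T -> 'I_D -> R) : R :=
  inf [set t | t0 <= t /\
    ('E_P[(fun w => residual2 gamma t (Y w))] <= kappa%:E)%E].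

Definition mutually_independent (R : realType) (d : measure_display)
    (T : measurableType d) (P : probability T R) (I : finType)
    (X : I -> {RV P >-> R}) : Prop :=
  forall (J : {set I}) (A : I -> set R),
    (forall i, i \in J -> measurable (A i)) ->
    P (\bigcap_(i in [set i | i \in J]) (X i @^-1` A i)) =
    (\prod_(i in J) P (X i @^-1` A i))%E.

Definition standard_normal (R : realType) (d : measure_display)
    (T : measurableType d) (P : probability T R) (X : {RV P >-> R}) : Prop :=
  forall A : set R, measurable A -> distribution P X A = normal_prob 0 1 A.

Definition mean_sq_error (R : realType) (d : measure_display)
    (T : measurableType d) (P : probability T R) (D : nat)
    (mu : 'I_D -> R) (muhat : T -> 'I_D -> R) : \bar R :=
  'E_P[fun w => enorm (fun i => muhat w i - mu i) ^+ 2].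

(* Main.v *)
(* The error of the stopped estimator is split into its squared bias and its noise.
   For a fixed time t the residual R_t^2 is a weighted non-central chi-square
   statistic, whose exponential moments at scale 1 / (delta^2 sqrt D) are explicit.
   - Stopping before t*: by (i) and the association inequality,
     B_tau^2 / B_{t*}^2 <= B_{tau,lambda}^2 / B_{t*,lambda}^2, and tau precedes the
     time t with B_{t,lambda}^2 = n B_{t*,lambda}^2 only if R_t^2 lies about
     (n - 1) B_{t*,lambda}^2 below its mean, which has exponentially small
     probability in n because B_{t*,lambda}^2 >= C_1 sqrt D delta^2.
   - Stopping after t*: tau exceeds the time t with V_{t,lambda} = K V_{t*,lambda}
     only if R_t^2 lies K sqrt D delta^2 / 4 above its mean, which has
     exponentially small probability in K because B_{t*,lambda}^2 <= C_2 D delta^2;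
     by (iii) the noise is then at most of order K^pi V_{t*}.
   Summing over n and K gives the two halves of the risk bound. *)
Require Import Defs.
From mathcomp Require Import all_boot all_order all_algebra.
From mathcomp Require Import all_classical all_reals all_analysis.
From mathcomp Require Import measurable_realfun ring lra.
Set Implicit Arguments.
Unset Strict Implicit.
Unset Printing Implicit Defensive.
Import Order.TTheory GRing.Theory Num.Theory.
Import numFieldNormedType.Exports.
Local Open Scope classical_set_scope.
Local Open Scope ring_scope.

(** * Monotonicity of the integral of nonnegative functions *)

Section expectation_nonneg.
Context d (T : measurableType d) (R : realType).
Variable mu : {measure set T -> \bar R}.
Local Open Scope ereal_scope.

(* No measurability: the stopped estimator need not be measurable. *)
Lemma ge0_le_integralT (f g : T -> \bar R) :
  (forall x, 0 <= f x) -> (forall x, f x <= g x) ->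
  \int[mu]_x f x <= \int[mu]_x g x.
Proof.
move=> f0 fg; rewrite !ge0_integralTE//; last first.
  by move=> x; exact: le_trans (fg x).
apply: ereal_sup_le => _ [h hf <-]; exists h => // x.
exact: le_trans (fg x).
Qed.

End expectation_nonneg.

(** * Transfer of integrals from indicators to nonnegative functions *)

Section change_of_measure.
Context d (T : measurableType d) d' (T' : measurableType d') (R : realType).
Variables (mu : {measure set T -> \bar R}) (nu : {measure set T' -> \bar R}).
Local Open Scope ereal_scope.

Import HBNNSimple.

(** Linearity gives the identity for simple functions and monotone convergence for their limits. The
    weight [G] serves two purposes: a product of other independent factors, and a density with
    respect to Lebesgue measure. *)
Lemma integral_eq_on_indic (G X : T -> R) (X' : T' -> R) (c : R)
    (h : R -> R) :
  (forall w, 0 <= G w)%R -> measurable_fun setT G -> measurable_fun setT X ->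
  measurable_fun setT X' ->
  (0 <= c)%R -> (forall x, (0 <= h x)%R) -> measurable_fun setT h ->
  (forall A, measurable A ->
     \int[mu]_w (G w * \1_A (X w))%:E = c%:E * \int[nu]_w (\1_A (X' w))%:E) ->
  \int[mu]_w (G w * h (X w))%:E = c%:E * \int[nu]_w (h (X' w))%:E.
Proof.
move=> G0 mG mX mX' c0 h0 mh GA.
have mhE : measurable_fun [set: R] (fun x => (h x)%:E) by exact/measurable_EFinP.
pose g := nnsfun_approx measurableT mhE.
have gh x : (g n x)%:E @[n --> \oo] --> (h x)%:E.
  by apply: cvg_nnsfun_approx => // y _; rewrite lee_fin.
have mgX n : measurable_fun setT (fun w => g n (X w)).
  by apply: (measurableT_comp _ mX); exact: measurable_funPT.
have mgX' n : measurable_fun setT (fun w => g n (X' w)).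
  by apply: (measurableT_comp _ mX'); exact: measurable_funPT.
have ndg x m n : (m <= n)%N -> (g m x <= g n x)%R.
  by move=> mn; exact/lefP/nd_nnsfun_approx.
have eq_g n : \int[mu]_w (G w * g n (X w))%:E
    = c%:E * \int[nu]_w (g n (X' w))%:E.
  have mind r : measurable_fun setT (fun w => \1_(g n @^-1` [set r]) (X w) : R).
    by apply: (measurableT_comp _ mX); exact: measurable_indic.
  have mind' r : measurable_fun setT (fun w => \1_(g n @^-1` [set r]) (X' w) : R).
    by apply: (measurableT_comp _ mX'); exact: measurable_indic.
  have gX x : g n x
      = (\sum_(r \in range (g n)) r * \1_(g n @^-1` [set r]) x)%R.
    exact: fimfunE.
  have r0 r x : (0 <= r * \1_(g n @^-1` [set r]) x)%R.
    rewrite indicE; case: (boolP (x \in _)) => [|_]; last by rewrite mulr0.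
    by rewrite inE /= => <-; rewrite mulr1.
  transitivity (\int[mu]_w (\sum_(r \in range (g n))
      (G w * (r * \1_(g n @^-1` [set r]) (X w)))%:E)).
    by apply: eq_integral => w _; rewrite gX fsumEFin// mulr_fsumr.
  transitivity (c%:E * \int[nu]_w (\sum_(r \in range (g n))
      (r * \1_(g n @^-1` [set r]) (X' w))%:E)); last first.
    by congr (_ * _); apply: eq_integral => w _; rewrite gX fsumEFin.
  rewrite !ge0_integral_fsum//.
  - rewrite ge0_mule_fsumr; last by move=> r; apply: integral_ge0 => w _;
      rewrite lee_fin.
    apply: eq_fsbigr => r /set_mem[x _ <-].
    under eq_integral do rewrite mulrCA EFinM.
    under [in RHS]eq_integral do rewrite EFinM.
    rewrite !ge0_integralZl_EFin//.
    + have mgr : measurable (g n @^-1` [set g n x]) by exact: measurable_funPTI.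
      by rewrite (GA _ mgr) muleCA.
    + exact/measurable_EFinP.
    + by move=> w _; rewrite lee_fin mulr_ge0.
    + by apply/measurable_EFinP; exact: measurable_funM.
  - by move=> r; apply/measurable_EFinP; exact: measurable_funM.
  - by move=> r w _; rewrite lee_fin.
  - move=> r; apply/measurable_EFinP.
    by apply: measurable_funM => //; exact: measurable_funM.
  - by move=> r w _; rewrite lee_fin mulr_ge0.
have cvgr : \int[nu]_w (g n (X' w))%:E @[n --> \oo] --> \int[nu]_w (h (X' w))%:E.
  have -> : \int[nu]_w (h (X' w))%:E
      = \int[nu]_w lim ((g n (X' w))%:E @[n --> \oo]).
    by apply: eq_integral => w _; apply/esym/cvg_lim.
  apply: cvg_monotone_convergence => //.
  - by move=> n; exact/measurable_EFinP.
  - by move=> n x _; rewrite lee_fin.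
  - by move=> x _ m n mn; rewrite lee_fin ndg.
have cvgl : \int[mu]_w (G w * g n (X w))%:E @[n --> \oo]
    --> \int[mu]_w (G w * h (X w))%:E.
  have -> : \int[mu]_w (G w * h (X w))%:E
      = \int[mu]_w lim ((G w * g n (X w))%:E @[n --> \oo]).
    apply: eq_integral => w _; apply/esym/cvg_lim => //.
    under eq_fun do rewrite EFinM.
    by rewrite EFinM; apply: cvgeZl.
  apply: cvg_monotone_convergence => //.
  - by move=> n; apply/measurable_EFinP; exact: measurable_funM.
  - by move=> n x _; rewrite lee_fin mulr_ge0.
  - by move=> x _ m n mn; rewrite lee_fin ler_wpM2l// ndg.
move: cvgl; under eq_cvg do rewrite eq_g.
by move=> /cvg_unique; apply => //; exact: cvgeZl.
Qed.

End change_of_measure.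

(** * Expectations of products of independent variables *)

Section independence.
Context (R : realType) d (T : measurableType d) (P : probability T R).
Variables (I : finType) (X : I -> {RV P >-> R}).
Hypothesis indep : mutually_independent X.

Lemma measurable_fun_prod_RV (g : I -> R -> R) (A : {pred I}) :
  (forall i, measurable_fun setT (g i)) ->
  measurable_fun setT (fun w => \prod_(i in A) g i (X i w)).
Proof.
move=> mg; apply: (@eq_measurable_fun _ _ _ _ _ (fun w =>
  \prod_(i <- [seq i <- index_enum I | i \in A]) g i (X i w))).
  by move=> w _; rewrite big_filter.
apply: measurable_prod => i _.
by apply: measurableT_comp => //; exact: measurable_funPT.
Qed.

(* Induction on the list [s] of the factors that are not indicators. *)
Lemma integral_prod_indep_seq (s : seq I) (g : I -> R -> R) (m : I -> R) :
  (forall i, measurable_fun setT (g i)) -> (forall i x, 0 <= g i x) ->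
  (forall i, (\int[P]_w (g i (X i w))%:E = (m i)%:E)%E) ->
  (forall i, i \notin s -> exists2 A, measurable A & g i = \1_A) ->
  (\int[P]_w (\prod_i g i (X i w))%:E = (\prod_i m i)%:E)%E.
Proof.
elim: s g m => [|i s IH] g m mg g0 mE gs.
  have /all_sig2[A mA gA] i : {A | measurable A & g i = \1_A}.
    by apply: cid2; exact: gs.
  pose J : {set I} := [set: I]%SET.
  have intA i : (\int[P]_w (g i (X i w))%:E = P (X i @^-1` A i))%E.
    rewrite gA (_ : (fun w => _) = EFin \o \1_(X i @^-1` A i)).
      by rewrite integral_indic ?setIT//; exact: measurable_funPTI.
    by apply/funext => w /=; rewrite !indicE.
  have -> : (\int[P]_w (\prod_i g i (X i w))%:E =
      P (\bigcap_(i in [set i | i \in J]) (X i @^-1` A i)))%E.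
    rewrite (_ : (fun w => _) =
       EFin \o \1_(\bigcap_(i in [set i | i \in J]) (X i @^-1` A i))).
      rewrite integral_indic ?setIT//.
      by apply: fin_bigcap_measurable => // i _; exact: measurable_funPTI.
    apply/funext => w /=; congr EFin; rewrite indicE.
    case: (boolP (w \in _)) => [/set_mem wA|/negP wA].
      by rewrite big1// => i _; rewrite gA indicE mem_set//; apply: wA;
          rewrite /= inE.
    have [i wAi] : exists i, ~ A i (X i w).
      apply: contrapT => nA; apply: wA; apply/mem_set => i _ /=.
      by apply: contrapT => nAi; apply: nA; exists i.
    by rewrite (bigD1 i)//= gA indicE memNset// mul0r.
  rewrite (indep (J := J) (A := A))//.
  rewrite (eq_bigr (fun i => (m i)%:E)) => [|i _]; last by rewrite -mE intA.
  rewrite prodEFin.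
  by congr EFin; apply: eq_bigl => i; rewrite inE.
pose G w := \prod_(j | j != i) g j (X j w).
pose c := \prod_(j | j != i) m j.
have m0 j : 0 <= m j.
  by rewrite -lee_fin -mE; apply: integral_ge0 => w _; rewrite lee_fin.
have mG : measurable_fun setT G
    by exact: (@measurable_fun_prod_RV _ (fun j => j != i)).
(* Once factor [i] is an indicator, the remaining list is short enough for the induction hypothesis;
   [integral_eq_on_indic] then restores [g i]. *)
have step (A : set R) : measurable A ->
    (\int[P]_w (G w * \1_A (X i w))%:E = c%:E * \int[P]_w (\1_A (X i w))%:E)%E.
  move=> mA.
  pose g' j := if j == i then \1_A else g j.
  have intA : (\int[P]_w (\1_A (X i w))%:E = (fine (P (X i @^-1` A)))%:E)%E.
    rewrite (_ : (fun w => _) = EFin \o \1_(X i @^-1` A)); last first.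
      by apply/funext => w /=; rewrite !indicE.
    rewrite integral_indic ?setIT//; last exact: measurable_funPTI.
    by rewrite fineK// fin_num_measure//; exact: measurable_funPTI.
  pose m' j := if j == i then fine (P (X i @^-1` A)) else m j.
  transitivity (\int[P]_w (\prod_j g' j (X j w))%:E)%E.
    apply: eq_integral => w _; rewrite [in RHS](bigD1 i)//= mulrC /g' eqxx.
    by congr (_ * _)%:E; apply: eq_bigr => j /negPf ->.
  rewrite (IH g' m'); last 4 first.
  - by move=> j; rewrite /g'; case: eqP => // _; exact: measurable_indic.
  - by move=> j x; rewrite /g'; case: eqP => // _; rewrite indicE.
  - by move=> j; rewrite /g' /m'; case: eqP => [->|//].
  - move=> j js; rewrite /g'; case: eqVneq => [_|ji]; first by exists A.
    by apply: gs; rewrite inE negb_or ji.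
  rewrite intA (bigD1 i)//= /m' eqxx mulrC EFinM; congr (_%:E * _)%E.
  by apply: eq_bigr => j /negPf ->.
transitivity (\int[P]_w (G w * g i (X i w))%:E)%E.
  by apply: eq_integral => w _; rewrite (bigD1 i)//= mulrC.
rewrite (@integral_eq_on_indic _ _ _ _ _ P P G (X i) (X i) c (g i))//.
- by rewrite mE [in RHS](bigD1 i)//= mulrC EFinM.
- by move=> w; apply: prodr_ge0.
- by apply: prodr_ge0.
Qed.

Lemma integral_prod_indep (g : I -> R -> R) (m : I -> R) :
  (forall i, measurable_fun setT (g i)) -> (forall i x, 0 <= g i x) ->
  (forall i, (\int[P]_w (g i (X i w))%:E = (m i)%:E)%E) ->
  (\int[P]_w (\prod_i g i (X i w))%:E = (\prod_i m i)%:E)%E.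
Proof.
move=> mg g0 mE; apply: (@integral_prod_indep_seq (enum I)) => // i.
by rewrite mem_enum.
Qed.

End independence.

(** * Exponential moments of a squared shifted Gaussian *)

Section gaussian.
Context (R : realType).
Implicit Types x a : R.

(** The range of [x] gives [(1 - 2 * x)^-1 <= 2]. The square root is handled by squaring and
    [1 + u <= expR u]; its term linear in [x] cancels the [- x] of the numerator, which leaves a
    purely quadratic exponent. *)
Lemma mgf_bound x a : `|x| <= 4^-1 ->
  expR (2 * x ^+ 2 * a ^+ 2 / (1 - 2 * x) - x) / Num.sqrt (1 - 2 * x)
  <= expR (4 * x ^+ 2 * (1 + a ^+ 2)).
Proof.
rewrite ler_norml => /andP[x1 x2]; have p0 : 0 < 1 - 2 * x by lra.
have p2 : (1 - 2 * x)^-1 <= 2 by rewrite invf_ple ?posrE//; lra.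
have sq : (Num.sqrt (1 - 2 * x))^-1 <= expR (x + 4 * x ^+ 2).
  rewrite -(@ler_pXn2r _ 2)//; last 2 first.
  - by rewrite nnegrE invr_ge0 sqrtr_ge0.
  - by rewrite nnegrE expR_ge0.
  rewrite exprVn sqr_sqrtr ?(ltW p0)// -expRM_natl.
  have -> : (1 - 2 * x)^-1 = 1 + 2 * x / (1 - 2 * x) by field; rewrite gt_eqF.
  apply: le_trans (expR_ge1Dx _) _; rewrite ler_expR.
  have -> : 2 * x / (1 - 2 * x) = 2 * x + 4 * x ^+ 2 / (1 - 2 * x).
    by field; rewrite gt_eqF.
  have := sqr_ge0 x; set q := (_ ^-1) in p2 *; nra.
apply: le_trans (ler_wpM2l (expR_ge0 _) sq) _; rewrite -expRD ler_expR.
have := mulr_ge0 (sqr_ge0 x) (sqr_ge0 a); set q := (_ ^-1) in p2 *; nra.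
Qed.

Context d (T : measurableType d) (P : probability T R).
Variable (Z : {RV P >-> R}).
Hypothesis ZN : standard_normal Z.

Lemma integral_standard_normal (h : R -> R) :
  (forall x, 0 <= h x) -> measurable_fun setT h ->
  (\int[P]_w (h (Z w))%:E =
   \int[lebesgue_measure]_x (normal_pdf 0 1 x * h x)%:E)%E.
Proof.
move=> h0 mh; have mpdf := measurable_normal_pdf (0 : R) 1.
rewrite (@integral_eq_on_indic _ _ _ _ _ lebesgue_measure P (normal_pdf 0 1)
  id Z 1 h)//.
- by rewrite mul1e.
- by move=> x; exact: normal_pdf_ge0.
- move=> A mA; rewrite mul1e.
  transitivity (P (Z @^-1` A)); last first.
    rewrite (_ : (fun w => _) = EFin \o \1_(Z @^-1` A)); last first.
      by apply/funext => w /=; rewrite !indicE.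
    by rewrite integral_indic ?setIT//; exact: measurable_funPTI.
  transitivity (normal_prob 0 1 A : \bar R); last by rewrite -ZN.
  rewrite /normal_prob [RHS]integral_mkcond; apply: eq_integral => x _.
  by rewrite epatch_indic /= EFinM.
Qed.

(** Completing the square turns the integrand into a constant times the normal density with mean [m]
    and variance [(1 - 2 * x)^-1], whose integral is 1. *)
Lemma gauss_mgf_eq x a : x < 2^-1 ->
  (\int[P]_w (expR (x * ((a + Z w) ^+ 2 - a ^+ 2 - 1)))%:E =
   (expR (2 * x ^+ 2 * a ^+ 2 / (1 - 2 * x) - x) / Num.sqrt (1 - 2 * x))%:E)%E.
Proof.
move=> x2; have p0 : 0 < 1 - 2 * x by lra.
pose s := (Num.sqrt (1 - 2 * x))^-1.
have s0 : s != 0 by rewrite invr_eq0 gt_eqF// sqrtr_gt0.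
have s2 : s ^+ 2 = (1 - 2 * x)^-1 by rewrite exprVn sqr_sqrtr// ltW.
pose m := 2 * x * a / (1 - 2 * x).
rewrite (@integral_standard_normal (fun z => expR (x * ((a + z) ^+ 2
    - a ^+ 2 - 1)))); last 2 first.
- by move=> z; exact: expR_ge0.
- apply: measurableT_comp => //; apply: measurable_funM => //.
  by do 2 apply: measurable_funB => //; apply: measurable_funX;
      exact: measurable_funD.
pose c := expR (2 * x ^+ 2 * a ^+ 2 / (1 - 2 * x) - x) / Num.sqrt (1 - 2 * x).
rewrite -/c -[RHS]mule1 -(integral_normal_pdf m s) -ge0_integralZl_EFin//;
    last 3 first.
- by move=> z _; rewrite lee_fin normal_pdf_ge0.
- by apply/measurable_EFinP; exact: measurable_normal_pdf.
- by rewrite divr_ge0 ?expR_ge0 ?sqrtr_ge0.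
apply: eq_integral => z _; rewrite -EFinM; congr EFin.
rewrite !normal_pdfE ?oner_eq0//= /normal_fun /c /normal_peak s2.
rewrite expr1n mul1r subr0.
have -> : Num.sqrt ((1 - 2 * x)^-1 * pi *+ 2)
    = (Num.sqrt (1 - 2 * x))^-1 * Num.sqrt (pi *+ 2).
  by rewrite -mulrnAr sqrtrM ?sqrtrV ?invr_ge0 ?ltW.
rewrite invfM invrK.
set q := Num.sqrt (1 - 2 * x); set r := Num.sqrt _.
have q0 : q != 0 by rewrite gt_eqF// sqrtr_gt0.
have r0 : r != 0 by rewrite gt_eqF// sqrtr_gt0 mulrn_wgt0// pi_gt0.
transitivity (r^-1 * (expR (- z ^+ 2 / 2) * expR (x * ((a + z) ^+ 2
    - a ^+ 2 - 1)))).
  by rewrite mulrA -mulr_natr mul1r.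
transitivity (r^-1 * (expR (2 * x ^+ 2 * a ^+ 2 / (1 - 2 * x) - x) *
    expR (- (z - m) ^+ 2 / ((1 - 2 * x)^-1 *+ 2)))); last by field; apply/andP.
congr (_ * _); rewrite -!expRD; congr expR; rewrite /m; field.
by rewrite gt_eqF.
Qed.

End gaussian.

(** * A calculus of upper bounds on expectations *)

Section mean_le.
Context d (T : measurableType d) (R : realType) (P : probability T R).
Implicit Types (f g : T -> R) (a b k : R).

(** Measurability and nonnegativity travel with the bound, so that majorants of stopped quantities
    can be added and scaled freely. *)
Definition mean_le f a :=
  [/\ measurable_fun setT f, forall w, 0 <= f w & (\int[P]_w (f w)%:E <= a%:E)%E].

Lemma mean_le_trans f a b : mean_le f a -> a <= b -> mean_le f b.
Proof.
by move=> [mf f0 fa] ab; split => //; apply: le_trans fa _; rewrite lee_fin.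
Qed.

Lemma mean_le_cst k : 0 <= k -> mean_le (fun=> k) k.
Proof.
by move=> k0; split => //; rewrite integral_cst//= probability_setT mule1.
Qed.

Lemma mean_leD f g a b :
  mean_le f a -> mean_le g b -> mean_le (fun w => f w + g w) (a + b).
Proof.
move=> [mf f0 fa] [mg g0 gb]; split.
- exact: measurable_funD.
- by move=> w; rewrite addr_ge0.
- under eq_integral do rewrite EFinD.
  rewrite ge0_integralD//; [by rewrite EFinD leeD| | | |];
    by [move=> w _; rewrite lee_fin | exact/measurable_EFinP].
Qed.

Lemma mean_leZ k f a : 0 <= k -> mean_le f a -> mean_le (fun w => k * f w) (k * a).
Proof.
move=> k0 [mf f0 fa]; split.
- exact: measurable_funM.
- by move=> w; rewrite mulr_ge0.
- under eq_integral do rewrite EFinM.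
  rewrite ge0_integralZl_EFin//;
    [|by move=> w _; rewrite lee_fin|exact/measurable_EFinP].
  by rewrite EFinM lee_wpmul2l// lee_fin.
Qed.

Lemma mean_le_sum (I : Type) (s : seq I) (F : I -> T -> R) (a : I -> R) :
  (forall i, mean_le (F i) (a i)) ->
  mean_le (fun w => \sum_(i <- s) F i w) (\sum_(i <- s) a i).
Proof.
move=> Fa; elim: s => [|i s IH].
  rewrite big_nil (_ : (fun w => _) = fun=> 0); first exact: mean_le_cst.
  by apply/funext => w; rewrite big_nil.
rewrite big_cons (_ : (fun w => _) = fun w => F i w + \sum_(j <- s) F j w).
  exact: mean_leD.
by apply/funext => w; rewrite big_cons.
Qed.

Lemma mean_le_le f g a : measurable_fun setT f -> (forall w, 0 <= f w) ->
  (forall w, f w <= g w) -> mean_le g a -> mean_le f a.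
Proof.
move=> mf f0 fg [mg g0 ga]; split => //; apply: le_trans ga.
by apply: ge0_le_integralT => w; rewrite lee_fin.
Qed.

Lemma mean_le_ge0 f a : mean_le f a -> 0 <= a.
Proof.
case=> mf f0 fa; rewrite -lee_fin; apply: le_trans fa.
by apply: integral_ge0 => w _; rewrite lee_fin.
Qed.

End mean_le.

(** * Second and fourth Gaussian moments from exponential ones *)

Section gaussian_moments.
Context (R : realType) d (T : measurableType d) (P : probability T R).
Variable (Z : {RV P >-> R}).
Hypothesis ZN : standard_normal Z.
Implicit Types x a p q : R.

Lemma mean_le_gauss_mgf x a : `|x| <= 4^-1 ->
  mean_le P (fun w => expR (x * ((a + Z w) ^+ 2 - a ^+ 2 - 1)))
    (expR (4 * x ^+ 2 * (1 + a ^+ 2))).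
Proof.
move=> x4; split.
- apply: measurableT_comp => //; apply: measurable_funM => //.
  do 2 apply: measurable_funB => //; apply: measurable_funX.
  by apply: measurable_funD => //; exact: measurable_funPT.
- by move=> w; exact: expR_ge0.
- rewrite gauss_mgf_eq//; last by move: x4; rewrite ler_norml => /andP[_]; lra.
  by rewrite lee_fin mgf_bound.
Qed.

Lemma expR_ge_sqr x : 0 <= x -> x ^+ 2 <= 4 * expR x.
Proof.
move=> x0; have := expR_ge1Dx (x / 2); set e := expR _ => ex.
have -> : expR x = e ^+ 2 by rewrite /e -expRM_natl; congr expR; field.
by nra.
Qed.

(* Compare 1 + x ((a + Z)^2 - a^2 - 1) with its exponential, for x of either sign,
   and let x tend to 0 in the bound on the exponential moment. *)
Lemma integral_gauss_sqr_center a :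
  (\int[P]_w ((a + Z w) ^+ 2)%:E = (a ^+ 2 + 1)%:E)%E.
Proof.
set k := a ^+ 2 + 1.
have k1 : 1 <= k by rewrite /k; have := sqr_ge0 a; lra.
have mZ : measurable_fun setT (fun w => (a + Z w) ^+ 2).
  by apply: measurable_funX; apply: measurable_funD => //; exact: measurable_funPT.
pose E x w := expR (x * ((a + Z w) ^+ 2 - a ^+ 2 - 1)).
have EE x : `|x| <= 4^-1 -> mean_le P (E x) (expR (4 * x ^+ 2 * k)).
  by rewrite /k addrC; exact: mean_le_gauss_mgf.
(* The second moment is finite because [u <= 4 * expR (u / 4)] reduces it to the exponential moment
   at the endpoint 1/4. *)
have [m mE] : exists m, (\int[P]_w ((a + Z w) ^+ 2)%:E = m%:E)%E.
  have [_ _ ub] : mean_le P (fun w => (a + Z w) ^+ 2)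
      (4 * expR (k / 4) * expR (4 * 4^-1 ^+ 2 * k)).
    apply: (@mean_le_le _ _ _ _ _ (fun w => 4 * expR (k / 4) * E 4^-1 w)) => //.
    - by move=> w; exact: sqr_ge0.
    - move=> w; rewrite /E -mulrA -expRD.
      have -> : k / 4 + 4^-1 * ((a + Z w) ^+ 2 - a ^+ 2 - 1) = (a + Z w) ^+ 2 / 4.
        by rewrite /k; field.
      by have := expR_ge1Dx ((a + Z w) ^+ 2 / 4); lra.
    - apply: mean_leZ; first by rewrite mulr_ge0 ?expR_ge0.
      by apply: EE; rewrite ger0_norm.
  exists (fine (\int[P]_w ((a + Z w) ^+ 2)%:E)%E); rewrite fineK//.
  rewrite ge0_fin_numE; first exact: le_lt_trans ub (ltry _).
  by apply: integral_ge0 => w _; rewrite lee_fin sqr_ge0.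
have fm : mean_le P (fun w => (a + Z w) ^+ 2) m.
  by split => // [w|]; [exact: sqr_ge0 | rewrite mE].
have up y : 0 <= y -> y <= 4^-1 -> 1 + y * m <= expR (4 * y ^+ 2 * k) + y * k.
  move=> y0 y4; have Ey : mean_le P (E y) (expR (4 * y ^+ 2 * k)).
    by apply: EE; rewrite ger0_norm.
  have [_ _] := mean_leD Ey (mean_le_cst P (mulr_ge0 y0 (le_trans ler01 k1))).
  move=> le_up; rewrite -lee_fin; apply: le_trans le_up.
  have -> : ((1 + y * m)%:E = \int[P]_w (1 + y * (a + Z w) ^+ 2)%:E)%E.
    under eq_integral do rewrite EFinD EFinM.
    rewrite ge0_integralD//; last 2 first.
    - by move=> w _; rewrite -EFinM lee_fin mulr_ge0// sqr_ge0.
    - by apply/measurable_EFinP; exact: measurable_funM.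
    rewrite ge0_integralZl_EFin//; last 2 first.
    - by move=> w _; rewrite lee_fin sqr_ge0.
    - exact/measurable_EFinP.
    by rewrite mE integral_cst//= probability_setT mule1.
  apply: ge0_le_integralT => w; rewrite lee_fin.
    by rewrite addr_ge0// mulr_ge0// sqr_ge0.
  by have := expR_ge1Dx (y * ((a + Z w) ^+ 2 - a ^+ 2 - 1)); rewrite /E /k; lra.
have dn y : 0 <= y -> y <= 4^-1 -> 1 + y * k <= expR (4 * y ^+ 2 * k) + y * m.
  move=> y0 y4; have Ey : mean_le P (E (- y)) (expR (4 * y ^+ 2 * k)).
    by rewrite -(sqrrN y); apply: EE; rewrite normrN ger0_norm.
  have [_ _] := mean_leD Ey (mean_leZ y0 fm).
  move=> le_up; rewrite -lee_fin; apply: le_trans le_up.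
  have -> : ((1 + y * k)%:E = \int[P]_w (1 + y * k)%:E)%E.
    by rewrite integral_cst//= probability_setT mule1.
  apply: ge0_le_integralT => w; rewrite lee_fin.
    by rewrite addr_ge0// mulr_ge0// (le_trans ler01).
  by have := expR_ge1Dx (- y * ((a + Z w) ^+ 2 - a ^+ 2 - 1)); rewrite /E /k; lra.
have ex (u : R) : 0 <= u -> u <= 2^-1 -> expR u <= 1 + 2 * u.
  move=> u0 u2; have := expR_ge1Dx (- u); rewrite expRN => h.
  have e0 := expR_gt0 u.
  have : (1 - u) * expR u <= 1 by rewrite -ler_pdivlMr// div1r.
  by nra.
rewrite mE; congr EFin; apply/eqP; apply: contraT => mk.
pose D : R := `|m - k|.
have D0 : 0 < D by rewrite normr_gt0 subr_eq0.
(* This [y] makes the exponent [4 * y ^+ 2 * k] equal to [y * D / (4 + D)]. The two bounds then give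
   [D * y <= 2 * y * D / (4 + D)], which is impossible for [D > 0]. *)
pose y := (4 * k)^-1 * (D / (4 + D)).
have D4p : 0 < 4 + D by lra.
have D4 : 0 < D / (4 + D) < 1 by rewrite divr_gt0//= ltr_pdivrMr//; lra.
have k4 : 0 < (4 * k)^-1 <= 4^-1.
  have k0 : 0 < 4 * k by lra.
  by rewrite invr_gt0 k0/= lef_pV2 ?posrE//; lra.
have yk : 4 * y * k = D / (4 + D).
  by rewrite /y; field; rewrite !gt_eqF//; lra.
have y0 : 0 < y by rewrite mulr_gt0//; lra.
have y4 : y <= 4^-1.
  by have [/andP[? ?] /andP[? ?]] := (k4, D4); rewrite /y; nra.
have u2 : 4 * y ^+ 2 * k <= 2^-1.
  have -> : 4 * y ^+ 2 * k = y * (4 * y * k) by ring.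
  by rewrite yk; have /andP[? ?] := D4; nra.
have u0 : 0 <= 4 * y ^+ 2 * k
    by rewrite mulr_ge0 ?(le_trans ler01 k1)// mulr_ge0 ?sqr_ge0.
have := ex _ u0 u2; have -> : 4 * y ^+ 2 * k = y * (4 * y * k) by ring.
rewrite yk => exy.
have : D * y <= 2 * (y * (D / (4 + D))).
  have := up _ (ltW y0) y4; have := dn _ (ltW y0) y4.
  have -> : 4 * y ^+ 2 * k = y * (4 * y * k) by ring.
  rewrite yk => h1 h2.
  have -> : D * y = `|(m - k) * y| by rewrite normrM (ger0_norm (ltW y0)).
  set q := D / (4 + D) in h1 h2 exy *; rewrite ler_norml.
  by apply/andP; split; lra.
have -> : 2 * (y * (D / (4 + D))) = y * D * (2 / (4 + D)) by ring.
have : 2 / (4 + D) < 1 by rewrite ltr_pdivrMr//; lra.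
by have := mulr_gt0 y0 D0; nra.
Qed.

Lemma integral_gauss_sqr p q :
  (\int[P]_w ((p + q * Z w) ^+ 2)%:E = (p ^+ 2 + q ^+ 2)%:E)%E.
Proof.
have [->|q0] := eqVneq q 0.
  under eq_integral do rewrite mul0r addr0.
  by rewrite integral_cst//= probability_setT mule1 expr0n addr0.
transitivity (\int[P]_w ((q ^+ 2)%:E * ((p / q + Z w) ^+ 2)%:E))%E.
  by apply: eq_integral => w _; rewrite -EFinM; congr EFin; field.
rewrite ge0_integralZl_EFin//; last 3 first.
- by move=> w _; rewrite lee_fin sqr_ge0.
- apply/measurable_EFinP; apply: measurable_funX.
  by apply: measurable_funD => //; exact: measurable_funPT.
- exact: sqr_ge0.
by rewrite integral_gauss_sqr_center -EFinM; congr EFin; field.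
Qed.

(** With [u = Z ^+ 2 / 4], the fourth power is [16 * u ^+ 2 <= 64 * expR u], and [expR u] is covered
    by the exponential moment at 1/4. *)
Lemma mean_le_gauss_pow4 : mean_le P (fun w => Z w ^+ 4) (64 * expR 1).
Proof.
have mZ : measurable_fun setT Z by exact: measurable_funPT.
have z4 : `|4^-1| <= 4^-1 :> R by rewrite ger0_norm.
have := mean_leZ (mulr_ge0 (ler0n R 64) (expR_ge0 4^-1)) (mean_le_gauss_mgf 0 z4).
move=> /mean_le_trans => /(_ (64 * expR 1)).
move=> h; have /h : 64 * expR 4^-1 * expR (4 * 4^-1 ^+ 2 * (1 + 0 ^+ 2)) <=
    64 * expR 1 :> R.
  rewrite -mulrA -expRD ler_pM2l// ler_expR.
  have -> : 4^-1 + 4 * 4^-1 ^+ 2 * (1 + 0 ^+ 2) = 2^-1 :> R by field.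
  by lra.
apply: mean_le_le => //.
- exact: measurable_funX.
- by move=> w; rewrite exprn_even_ge0.
- move=> w; rewrite -mulrA -expRD.
  have -> : 4^-1 + 4^-1 * ((0 + Z w) ^+ 2 - 0 ^+ 2 - 1) = Z w ^+ 2 / 4 by field.
  have z0 : 0 <= Z w ^+ 2 / 4 by rewrite divr_ge0 ?sqr_ge0.
  have := expR_ge_sqr z0.
  have -> : Z w ^+ 4 = 16 * (Z w ^+ 2 / 4) ^+ 2 by field.
  by lra.
Qed.

End gaussian_moments.

(** * Quadratic forms in independent standard normals *)

Section gaussian_vector.
Context (R : realType) d (T : measurableType d) (P : probability T R) (D : nat).
Variable (eps : 'I_D -> {RV P >-> R}).
Hypothesis indep : mutually_independent eps.
Hypothesis normal : forall i, standard_normal (eps i).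
Implicit Types (p q a c w : 'I_D -> R).

Lemma integral_sum_gauss_sqr p q :
  (\int[P]_t (\sum_i (p i + q i * eps i t) ^+ 2)%:E
   = (\sum_i (p i ^+ 2 + q i ^+ 2))%:E)%E.
Proof.
under eq_integral do rewrite -sumEFin.
rewrite ge0_integral_sum//; last 2 first.
- move=> i; apply/measurable_EFinP; apply: measurable_funX.
  by apply: measurable_funD => //; apply: measurable_funM => //;
      exact: measurable_funPT.
- by move=> i t _; rewrite lee_fin sqr_ge0.
by under eq_bigr do rewrite integral_gauss_sqr//; rewrite sumEFin.
Qed.

(** Independence factorises the exponential. Weights in [0, 1] keep each [x * w i] in the admissible
    range, and [w i ^+ 2 <= w i] leaves the weights linear in the bound. *)
Lemma mean_le_exp_quadratic (x : R) w a :
  `|x| <= 4^-1 -> (forall i, 0 <= w i <= 1) ->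
  mean_le P
    (fun t => expR (x * \sum_i w i * ((a i + eps i t) ^+ 2 - a i ^+ 2 - 1)))
    (expR (4 * x ^+ 2 * (D%:R + \sum_i w i * a i ^+ 2))).
Proof.
move=> x4 w01.
pose g i z := expR (x * w i * ((a i + z) ^+ 2 - a i ^+ 2 - 1)).
have mg i : measurable_fun setT (g i).
  apply: measurableT_comp => //; apply: measurable_funM => //.
  by do 2 apply: measurable_funB => //; apply: measurable_funX;
      exact: measurable_funD.
have g0 i z : 0 <= g i z by exact: expR_ge0.
have xw i : `|x * w i| <= 4^-1.
  have /andP[w0 w1] := w01 i; rewrite normrM (ger0_norm w0).
  by apply: le_trans x4; rewrite ler_piMr.
pose m i := expR (2 * (x * w i) ^+ 2 * a i ^+ 2 / (1 - 2 * (x * w i)) - x * w i)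
  / Num.sqrt (1 - 2 * (x * w i)).
have gE t : expR (x * \sum_i w i * ((a i + eps i t) ^+ 2 - a i ^+ 2 - 1))
    = \prod_i g i (eps i t).
  rewrite mulr_sumr expR_sum; apply: eq_bigr => i _.
  by rewrite /g mulrA.
split.
- rewrite (_ : (fun t => _) = (fun t => \prod_i g i (eps i t))); last exact/funext.
  apply: measurable_prod => i _.
  by apply: measurableT_comp => //; exact: measurable_funPT.
- by move=> t; exact: expR_ge0.
under eq_integral do rewrite gE.
rewrite (integral_prod_indep indep (m := m))//; last first.
  move=> i; rewrite /g gauss_mgf_eq//.
  by have := xw i; rewrite ler_norml => /andP[_]; lra.
rewrite lee_fin.
apply: (@le_trans _ _ (\prod_i expR (4 * (x * w i) ^+ 2 * (1 + a i ^+ 2)))).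
  by apply: ler_prod => i _;
      rewrite mgf_bound// andbT divr_ge0 ?expR_ge0 ?sqrtr_ge0.
rewrite -expR_sum ler_expR.
have -> : D%:R = \sum_(i < D) (1 : R) by rewrite sumr_const card_ord.
rewrite -big_split/= mulr_sumr; apply: ler_sum => i _.
have /andP[w0 w1] := w01 i.
have -> : 4 * (x * w i) ^+ 2 * (1 + a i ^+ 2) =
    4 * x ^+ 2 * (w i ^+ 2 * (1 + a i ^+ 2)) by ring.
apply: ler_wpM2l; first by rewrite mulr_ge0// sqr_ge0.
have w2 : w i ^+ 2 <= w i by rewrite expr2 ler_piMl.
by have := ler_wpM2r (sqr_ge0 (a i)) w2; lra.
Qed.

(** Weighted Cauchy-Schwarz bounds the square by the total weight times a weighted sum of fourth
    powers; Lagrange's identity displays the gap as a double sum of nonnegative terms. *)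
Lemma mean_le_sqr_weighted_chi2 c : (forall i, 0 <= c i) ->
  mean_le P (fun t => (\sum_i c i * eps i t ^+ 2) ^+ 2)
    (64 * expR 1 * (\sum_i c i) ^+ 2).
Proof.
move=> c0; have me i : measurable_fun setT (eps i) by exact: measurable_funPT.
have := @mean_le_sum _ _ _ P _ (index_enum 'I_D)
  (fun i t => c i * eps i t ^+ 4) (fun i => c i * (64 * expR 1))
  (fun i => mean_leZ (c0 i) (mean_le_gauss_pow4 (normal i))).
have s0 : 0 <= \sum_i c i by exact: sumr_ge0.
move=> /(mean_leZ s0).
have -> : (\sum_i c i) * (\sum_i c i * (64 * expR 1)) =
    64 * expR 1 * (\sum_i c i) ^+ 2.
  by rewrite -mulr_suml; ring.
apply: mean_le_le.
- by apply: measurable_funX; apply: measurable_sum => i;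
    apply: measurable_funM => //; exact: measurable_funX.
- by move=> t; exact: sqr_ge0.
move=> t.
rewrite -subr_ge0.
have -> : (\sum_i c i) * (\sum_i c i * eps i t ^+ 4)
    - (\sum_i c i * eps i t ^+ 2) ^+ 2
   = 2^-1 * \sum_i \sum_j c i * c j * (eps i t ^+ 2 - eps j t ^+ 2) ^+ 2.
  have E (f g : 'I_D -> R) : (\sum_i f i) * (\sum_j g j) = \sum_i \sum_j f i * g j.
    by rewrite mulr_suml; apply: eq_bigr => i _; rewrite mulr_sumr.
  transitivity (2^-1 * ((\sum_i c i) * (\sum_i c i * eps i t ^+ 4)
     + (\sum_i c i * eps i t ^+ 4) * (\sum_i c i)
     - 2 * ((\sum_i c i * eps i t ^+ 2) * (\sum_i c i * eps i t ^+ 2)))).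
    by field.
  congr (_ * _); rewrite !E -big_split mulr_sumr -sumrB; apply: eq_bigr => i _.
  rewrite -big_split mulr_sumr -sumrB; apply: eq_bigr => j _ /=; ring.
rewrite mulr_ge0//; apply: sumr_ge0 => i _; apply: sumr_ge0 => j _.
by rewrite mulr_ge0 ?sqr_ge0// mulr_ge0.
Qed.

End gaussian_vector.

(** * Infima of crossing times of continuous monotone functions *)

Section first_crossing.
Context (R : realType).
Implicit Types (f : R -> R) (a b c t : R).

Lemma ivt_nonneg f a b c : 0 <= a -> a <= b ->
  {within `[0, +oo[, continuous f} ->
  Num.min (f a) (f b) <= c <= Num.max (f a) (f b) ->
  exists2 t, a <= t <= b & f t = c.
Proof.
move=> a0 ab cf fc.
have cab : {within `[a, b], continuous f}.
  apply: continuous_subspaceW cf => t /=; rewrite !in_itv/= andbT.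
  by move=> /andP[at_ _]; exact: le_trans at_.
have [t tab ft] := IVT ab cab fc.
by exists t => //; move: tab; rewrite in_itv.
Qed.

(** Continuity prevents a jump across [kappa]. This covers both stopping rules: [f] is the residual
    of a fixed outcome or the mean residual. *)
Lemma inf_crossing f (t0 kappa : R) : 0 <= t0 ->
  {within `[0, +oo[, continuous f} ->
  (forall s t, 0 <= s -> s <= t -> f t <= f s) ->
  (exists2 t, t0 <= t & f t <= kappa) ->
  let ts := inf [set t | t0 <= t /\ f t <= kappa] in
  [/\ t0 <= ts, f ts <= kappa, t0 < ts -> kappa <= f ts &
      forall t, t0 <= t -> t < ts -> kappa < f t].
Proof.
move=> t00 cf nf [u t0u fu] ts; pose A := [set t | t0 <= t /\ f t <= kappa].
have Au : A u by [].
have lbA : has_lbound A by exists t0 => t [].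
have t0ts : t0 <= ts by apply: lb_le_inf => [|t []]; first by exists u.
have ts0 : 0 <= ts by exact: le_trans t0ts.
have before t : t0 <= t -> t < ts -> kappa < f t.
  move=> t0t tts; rewrite ltNge; apply/negP => ftk.
  by have := ge_inf lbA (conj t0t ftk); rewrite leNgt tts.
have at_ : f ts <= kappa.
  rewrite leNgt; apply/negP => fts.
  have tsu : ts <= u by exact: ge_inf.
  (* The midpoint value is taken strictly after [ts] and exceeds [kappa], yet some earlier time
     already lies in the set, against monotonicity. *)
  have [|t /andP[tst tu] ft] := @ivt_nonneg f ts u ((f ts + kappa) / 2) ts0 tsu cf.
    by rewrite ge_min le_max; apply/andP; split; apply/orP; [right|left]; lra.
  have tst' : ts < t.
    by rewrite lt_neqAle tst andbT; apply/eqP => E; move: ft; rewrite -E; lra.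
  have [w [t0w fw] wt] : exists2 w, A w & w < t
    by apply: inf_lt => //; exists u.
  have := nf w t (le_trans t00 t0w) (ltW wt); lra.
split => // t0ts'; rewrite leNgt; apply/negP => fts.
have ft0 := before t0 (lexx _) t0ts'.
have [|t /andP[t0t tts] ft] := @ivt_nonneg f t0 ts kappa t00 t0ts cf.
  by rewrite ge_min le_max (ltW fts) (ltW ft0) orbT.
have : ts <= t by apply: ge_inf => //; split => //; rewrite ft.
by move=> tst; move: fts; rewrite (le_anti (introT andP (conj tst tts))) ft ltxx.
Qed.

(** The same midpoint argument for a nondecreasing function; it yields the lower bound on the weak
    variance at the initial time. *)
Lemma inf_level f c : {within `[0, +oo[, continuous f} ->
  (forall s t, 0 <= s -> s <= t -> f s <= f t) ->
  f 0 <= c -> (exists2 t, 0 <= t & c <= f t) ->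
  let ts := inf [set t | 0 <= t /\ f t = c] in 0 <= ts /\ c <= f ts.
Proof.
move=> cf nf f0 [v v0 fv] ts; pose A := [set t | 0 <= t /\ f t = c].
have [|u /andP[u0 uv] fu] := @ivt_nonneg f 0 v c (lexx _) v0 cf.
  by rewrite ge_min le_max f0 fv orbT.
have Au : A u by [].
have lbA : has_lbound A by exists 0 => t [].
have ts0 : 0 <= ts by apply: lb_le_inf => [|t []]; first by exists u.
split => //; rewrite leNgt; apply/negP => fts.
have tsu : ts <= u by exact: ge_inf.
have [|t /andP[tst tu] ft] := @ivt_nonneg f ts u ((f ts + c) / 2) ts0 tsu cf.
  by rewrite fu ge_min le_max; apply/andP; split; apply/orP; [left|right]; lra.
have tst' : ts < t.
  by rewrite lt_neqAle tst andbT; apply/eqP => E; move: ft; rewrite -E; lra.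
have [w [w0 fw] wt] : exists2 w, A w & w < t
    by apply: inf_lt => //; exists u.
by have := nf w t w0 (ltW wt); lra.
Qed.

End first_crossing.

(** * Continuity, monotonicity and limits of sums over the filters *)

Section filters.
Context (R : realType) (D : nat) (gamma : 'I_D -> R -> R).
Hypothesis filt : forall i, is_filter (gamma i).
Implicit Types (s t : R) (k : 'I_D -> R).

Lemma filter_itv i t : 0 <= t -> 0 <= gamma i t <= 1.
Proof. by case: (filt i) => + _ _ _ _; apply. Qed.

Lemma filter_le i s t : 0 <= s -> s <= t -> gamma i s <= gamma i t.
Proof. by case: (filt i) => _ _ + _ _; apply. Qed.

Lemma filters_near1 s e : 0 < e -> exists2 t, s <= t /\ 0 <= t &
  forall i, 1 - e <= gamma i t.
Proof.
move=> e0.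
have H : \forall t \near +oo, forall i, 1 - e <= gamma i t.
  apply: filter_forall => i; case: (filt i) => _ _ _ _ /cvgrPdist_le/(_ e e0).
  by apply: filterS => t; rewrite ler_norml => /andP[_ ?]; lra.
have /filter_ex[t [Ht [st t0]]] : \forall t \near +oo,
    (forall i, 1 - e <= gamma i t) /\ (s <= t /\ 0 <= t).
  apply: filterI => //; apply: filterI; apply: nbhs_pinfty_ge; exact: num_real.
by exists t.
Qed.

Lemma continuous_filter_sum (h : 'I_D -> R -> R) :
  (forall i, continuous (h i)) ->
  {within `[0, +oo[, continuous (fun t => \sum_i h i (gamma i t))}.
Proof.
move=> ch x; apply: cvg_big => [|i _]; first exact: add_continuous.
by apply: continuous_comp; [case: (filt i) => _ cg _ _ _; exact: cg|exact: ch].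
Qed.

Lemma continuous_filter_residual k :
  {within `[0, +oo[, continuous (fun t => \sum_i (1 - gamma i t) ^+ 2 * k i)}.
Proof.
apply: (continuous_filter_sum (h := fun i y => (1 - y) ^+ 2 * k i)) => i y.
apply: cvgM; last exact: cvg_cst.
by apply: cvgM; apply: cvgB => //; exact: cvg_cst.
Qed.

Lemma filter_residual_le k s t : (forall i, 0 <= k i) -> 0 <= s -> s <= t ->
  \sum_i (1 - gamma i t) ^+ 2 * k i <= \sum_i (1 - gamma i s) ^+ 2 * k i.
Proof.
move=> k0 s0 st; apply: ler_sum => i _; apply: ler_wpM2r => //.
have t0 := le_trans s0 st.
have := filter_itv i s0; have := filter_itv i t0; have := filter_le i s0 st.
by move=> ? /andP[? ?] /andP[? ?]; nra.
Qed.

Lemma filter_residual_small k s e : (forall i, 0 <= k i) -> 0 < e ->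
  exists2 t, s <= t & \sum_i (1 - gamma i t) ^+ 2 * k i <= e.
Proof.
move=> k0 e0; set K := \sum_i k i.
have K0 : 0 <= K by exact: sumr_ge0.
(* The denominator ensures both [d <= 1], so that [d ^+ 2 <= d], and [d * K <= e]. *)
have d0 : 0 < e / (1 + K + e) by rewrite divr_gt0//; lra.
have [t [st t0] gt] := filters_near1 s d0; exists t => //.
set d := e / _ in d0 gt.
have d1 : d <= 1 by rewrite /d ler_pdivrMr; lra.
have dK : d * K <= e.
  by rewrite /d mulrAC ler_pdivrMr; [nra | lra].
apply: le_trans dK; rewrite mulr_sumr; apply: ler_sum => i _.
apply: ler_wpM2r => //; have := gt i; have /andP[? ?] := filter_itv i t0.
by move=> ?; nra.
Qed.

Lemma continuous_filter_sqr :
  {within `[0, +oo[, continuous (fun t => \sum_i gamma i t ^+ 2)}.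
Proof.
apply: (continuous_filter_sum (h := fun i y => y ^+ 2)) => i y.
by apply: cvgM.
Qed.

Lemma filter_sqr_le s t : 0 <= s -> s <= t ->
  \sum_i gamma i s ^+ 2 <= \sum_i gamma i t ^+ 2.
Proof.
move=> s0 st; apply: ler_sum => i _.
have /andP[? ?] := filter_itv i s0; have := filter_le i s0 st => ?; nra.
Qed.

Lemma filter_sqr_le_dim t : 0 <= t -> \sum_i gamma i t ^+ 2 <= D%:R.
Proof.
move=> t0; rewrite -[X in X%:R]card_ord -sumr_const; apply: ler_sum => i _.
by have /andP[? ?] := filter_itv i t0; nra.
Qed.

Lemma filter_sqr_large c : c < D%:R ->
  exists2 t, 0 <= t & c <= \sum_i gamma i t ^+ 2.
Proof.
move=> cD; have [D0|D0] := posnP D.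
  have c0 : c <= 0 by apply: le_trans (ltW cD) _; rewrite D0.
  by exists 0 => //; apply: le_trans c0 (sumr_ge0 _ _) => i _; exact: sqr_ge0.
(* A filter value above [1 - e] has square at least [1 - 2 * e], and these lower bounds add up to
   exactly [c]. *)
pose e : R := (D%:R - c) / (2 * D%:R).
have D0' : 0 < D%:R :> R by rewrite ltr0n.
have e0 : 0 < e by rewrite divr_gt0//; lra.
have eD : 2 * e * D%:R = D%:R - c by rewrite /e; field; rewrite gt_eqF.
have [t [_ t0] gt] := filters_near1 0 e0; exists t => //.
apply: (@le_trans _ _ (\sum_(i < D) (1 - 2 * e))).
  by rewrite sumr_const card_ord -mulr_natr; lra.
apply: ler_sum => i _; have := gt i; have /andP[? ?] := filter_itv i t0.
by move=> ?; nra.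
Qed.

Lemma filter_sqr_reach ts c : 0 <= ts -> \sum_i gamma i ts ^+ 2 <= c -> c < D%:R ->
  exists2 t, ts <= t & \sum_i gamma i t ^+ 2 = c.
Proof.
move=> ts0 tsc /filter_sqr_large[u u0 cu].
have tsu : ts <= Num.max ts u by rewrite le_max lexx.
have cu' : c <= \sum_i gamma i (Num.max ts u) ^+ 2.
  by apply: le_trans cu (filter_sqr_le u0 _); rewrite le_max lexx orbT.
have [|t /andP[tst _] vt] := ivt_nonneg ts0 tsu continuous_filter_sqr (c := c).
  by rewrite ge_min le_max cu' orbT tsc.
by exists t.
Qed.

(* Times at which the weak variance reaches a multiple of its value at [ts]; the
   factor 2 lets a time with all filters above 1/2 serve when [K] is so large
   that this multiple exceeds [D]. *)
Lemma filter_level ts K : 0 <= ts -> 1 <= K ->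
  let v t := \sum_i gamma i t ^+ 2 in
  exists2 s, ts <= s /\ v s <= K * v ts &
    forall t, ts <= t -> v t <= K * v ts -> forall i, gamma i t <= 2 * gamma i s.
Proof.
move=> ts0 K1 v.
have v0 : 0 <= v ts by apply: sumr_ge0 => i _; exact: sqr_ge0.
have half_gt0 : 0 < 2^-1 :> R by rewrite invr_gt0.
have [DK|KD] := leP (D%:R) (K * v ts).
  have [s [tss s0] gs] := filters_near1 ts half_gt0.
  exists s; first by split => //; exact: le_trans (filter_sqr_le_dim s0) _.
  move=> t tst _ i; have /andP[_] := filter_itv i (le_trans ts0 tst).
  by have := gs i; lra.
have tsK : v ts <= K * v ts by rewrite ler_peMl.
have [s tss vs] := filter_sqr_reach ts0 tsK KD.
have s0 := le_trans ts0 tss.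
exists s; first by split => //; rewrite /v vs.
move=> t tst vt i; have /andP[gs0 _] := filter_itv i s0.
have [tlts|slt] := leP t s.
  by have := filter_le i (le_trans ts0 tst) tlts; lra.
have gst j := filter_le j s0 (ltW slt).
(* Every square grows from [s] to [t] while the sum does not, so no single square can grow. *)
suff : gamma i t ^+ 2 <= gamma i s ^+ 2.
  by have := gst i => ? ?; nra.
have : v t <= v s by rewrite {2}/v vs.
rewrite /v (bigD1 i)//= [X in _ <= X -> _](bigD1 i)//=.
have : \sum_(j | j != i) gamma j s ^+ 2 <= \sum_(j | j != i) gamma j t ^+ 2.
  apply: ler_sum => j _; have /andP[? ?] := filter_itv j s0.
  by have := gst j => ?; nra.
by lra.
Qed.

End filters.

(** * Elementary inequalities *)

Section elementary.
Context (R : realType).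

(* Chebyshev's association inequality, by symmetrising the double sum. *)
Lemma association_ineq (D : nat) (p q l x : 'I_D -> R) :
  (forall i, 0 <= x i) ->
  (forall i j : 'I_D, (i <= j)%N -> l j <= l i) ->
  (forall i j : 'I_D, (i <= j)%N -> p j * q i <= p i * q j) ->
  (\sum_i p i * x i) * (\sum_i q i * l i * x i) <=
  (\sum_i p i * l i * x i) * (\sum_i q i * x i).
Proof.
move=> x0 lmon pq; rewrite -subr_ge0.
have E (f g : 'I_D -> R) : (\sum_i f i) * (\sum_j g j) = \sum_i \sum_j f i * g j.
  by rewrite mulr_suml; apply: eq_bigr => i _; rewrite mulr_sumr.
have -> : (\sum_i p i * l i * x i) * (\sum_i q i * x i)
    - (\sum_i p i * x i) * (\sum_i q i * l i * x i)
  = 2^-1 * \sum_i \sum_j (p i * q j - p j * q i) * (l i - l j) * (x i * x j).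
  transitivity (2^-1 * ((\sum_i p i * l i * x i) * (\sum_i q i * x i)
    + (\sum_i q i * x i) * (\sum_i p i * l i * x i)
    - (\sum_i p i * x i) * (\sum_i q i * l i * x i)
    - (\sum_i q i * l i * x i) * (\sum_i p i * x i))); first by field.
  congr (_ * _); rewrite !E -big_split -!sumrB; apply: eq_bigr => i _.
  by rewrite -big_split -!sumrB; apply: eq_bigr => j _ /=; ring.
rewrite mulr_ge0//; apply: sumr_ge0 => i _; apply: sumr_ge0 => j _.
rewrite mulr_ge0//; last by rewrite mulr_ge0.
have [ij|/ltnW ji] := leqP i j.
  by rewrite mulr_ge0// subr_ge0; [exact: pq|exact: lmon].
by rewrite -mulrNN mulr_ge0// opprB subr_ge0; [exact: pq|exact: lmon].
Qed.

(** Cross-multiplied and squared, the ratio condition fits the association inequality. If [1 - a]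
    vanishes, so does the left side; if only [1 - b] does, an infinite ratio would lie below a
    finite one. *)
Lemma filter_ratio_cross (a a' b b' : R) : a <= 1 -> a' <= 1 -> b <= 1 -> b' <= 1 ->
  (filter_ratio b' b <= filter_ratio a' a)%E ->
  (1 - b') ^+ 2 * (1 - a) ^+ 2 <= (1 - a') ^+ 2 * (1 - b) ^+ 2.
Proof.
move=> a1 a'1 b1 b'1; rewrite /filter_ratio.
have [a0 _|a0] := eqVneq (1 - a) 0.
  by rewrite a0 expr0n/= mulr0 mulr_ge0 ?sqr_ge0.
have [_|b0] := eqVneq (1 - b) 0; first by rewrite leye_eq.
have a0' : 0 < 1 - a by rewrite lt_neqAle eq_sym a0 subr_ge0.
have b0' : 0 < 1 - b by rewrite lt_neqAle eq_sym b0 subr_ge0.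
rewrite lee_fin ler_pdivrMr// mulrAC ler_pdivlMr// -!exprMn => h.
have ? : 0 <= (1 - b') * (1 - a) by rewrite mulr_ge0 ?subr_ge0// ltW.
by rewrite ler_pXn2r// nnegrE; lra.
Qed.

(** Apply [ln y <= y - 1] at [y = x * (c / p)] and multiply by [p]. *)
Lemma powR_le_expR (p c : R) : 0 < p -> 0 < c ->
  exists2 A, 0 <= A & forall x, 1 <= x -> x `^ p <= A * expR (c * x).
Proof.
move=> p0 c0; exists (expR (- p - p * ln (c / p))); first exact: expR_ge0.
move=> x x1; have x0 : 0 < x by lra.
rewrite /powR gt_eqF// -expRD ler_expR.
have cp0 : 0 < c / p by rewrite divr_gt0.
have h : ln (x * (c / p)) <= x * (c / p) - 1.
  rewrite -{1}(subrKC 1 (x * (c / p))); apply: le_ln1Dx.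
  by have := mulr_gt0 x0 cp0; lra.
rewrite lnM ?posrE// in h.
have -> : c * x = p * (x * (c / p)) by field; rewrite gt_eqF.
by have := ler_wpM2l (ltW p0) h; rewrite [p * ln x]mulrC; lra.
Qed.

Lemma sum_expR_le (c : R) (N : nat) : 0 < c ->
  \sum_(n < N) expR (- c * n%:R) <= (1 - expR (- c))^-1.
Proof.
move=> c0; have q1 : expR (- c) < 1 by rewrite -expR0 ltr_expR oppr_lt0.
have q0 := expR_gt0 (- c); set q := expR _ in q0 q1 *.
under eq_bigr do rewrite mulrC expRM_natl -/q.
rewrite -div1r ler_pdivlMr ?subr_gt0// mulrC.
have -> : (1 - q) * (\sum_(n < N) q ^+ n) = 1 - q ^+ N.
  by rewrite -opprB mulNr -subrX1 opprB.
by have := exprn_ge0 N (ltW q0); lra.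
Qed.

(** A pathwise layer-cake bound: each threshold [n + 2] passed by [x] is paid for by a term
    [u n >= 1]. *)
Lemma le_sum_thresholds (N : nat) (x : R) (u : nat -> R) :
  x <= N%:R + 2 -> (forall n, 0 <= u n) -> (forall n, n%:R + 2 < x -> 1 <= u n) ->
  x <= 2 + \sum_(n < N) u n.
Proof.
move=> + u0; elim: N x => [|N IH] x xN ux; first by rewrite big_ord0; lra.
rewrite big_ord_recr/=; have [xN'|Nx] := leP x (N%:R + 2).
  by have := IH x xN' ux; have := u0 N; lra.
have := IH (N%:R + 2) (lexx _) => IH'.
have : N%:R + 2 <= 2 + \sum_(n < N) u n.
  by apply: IH' => n nN; apply: ux; exact: lt_trans Nx.
by have := ux N Nx; move: xN; rewrite -natr1; lra.
Qed.

(** Beyond 4, [x] is placed in one unit cell, so that a single term of a sum over cells can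
    dominate. *)
Lemma threshold_bracket (N : nat) (x : R) : x <= N%:R + 4 ->
  x <= 4 \/ exists2 n, (n < N)%N & n%:R + 4 < x <= n%:R + 5.
Proof.
elim: N => [|N IH] xN; first by left; move: xN; rewrite add0r.
have [/IH[?|[n nN nx]]|Nx] := leP x (N%:R + 4); [by left| |].
  by right; exists n => //; exact: ltnW.
by right; exists N => //; rewrite Nx /=; move: xN; rewrite -natr1; lra.
Qed.

End elementary.

(** * Residual, bias and noise of the filter estimators *)

Section early_stopping.
Context (R : realType) (D : nat) (delta : R) (lambda mu : 'I_D -> R)
  (gamma : 'I_D -> R -> R).
Context d (T : measurableType d) (P : probability T R) (eps : 'I_D -> {RV P >-> R}).
Hypothesis delta0 : 0 < delta.
Hypothesis lambda01 : forall i, 0 < lambda i <= 1.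
Hypothesis indep : mutually_independent eps.
Hypothesis normal : forall i, standard_normal (eps i).
Hypothesis filt : forall i, is_filter (gamma i).
Hypothesis D_gt0 : (0 < D)%N.

Let Y w := observation delta lambda mu (fun i => eps i w).
(** Noncentrality parameters: the residual is [delta ^+ 2] times a weighted noncentral chi-square
    with these shifts. *)
Let a i := lambda i * mu i / delta.

Definition strong_bias2 t := \sum_i (1 - gamma i t) ^+ 2 * mu i ^+ 2.

Definition mean_residual2 t :=
  \sum_i (1 - gamma i t) ^+ 2 * (lambda i ^+ 2 * mu i ^+ 2 + delta ^+ 2).

(** Stochastic part of the squared error, with mean [var] at a fixed time; it is also evaluated
    pathwise at the stopping time. *)
Definition noise2 t w := \sum_i delta ^+ 2 * (gamma i t ^+ 2 * lambda i ^- 2) *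
    eps i w ^+ 2.

Lemma observationE w i : Y w i = delta * (a i + eps i w).
Proof. by rewrite /Y /observation /a; field; rewrite gt_eqF. Qed.

Lemma residual2E t w : residual2 gamma t (Y w) =
  delta ^+ 2 * \sum_i (1 - gamma i t) ^+ 2 * (a i + eps i w) ^+ 2.
Proof.
rewrite /residual2 mulr_sumr; apply: eq_bigr => i _.
by rewrite observationE; ring.
Qed.

Lemma mean_residual2E t : mean_residual2 t =
  delta ^+ 2 * \sum_i (1 - gamma i t) ^+ 2 * (a i ^+ 2 + 1).
Proof.
rewrite /mean_residual2 mulr_sumr; apply: eq_bigr => i _.
by rewrite /a; field; rewrite gt_eqF.
Qed.

Lemma weak_bias2E t : weak_bias2 gamma lambda mu t =
  delta ^+ 2 * \sum_i (1 - gamma i t) ^+ 2 * a i ^+ 2.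
Proof.
rewrite /weak_bias2 mulr_sumr; apply: eq_bigr => i _.
by rewrite /a; field; rewrite gt_eqF.
Qed.

Lemma expectation_residual2 t :
  'E_P[(fun w => residual2 gamma t (Y w))]%E = (mean_residual2 t)%:E.
Proof.
rewrite unlock.
transitivity (\int[P]_w (\sum_i ((1 - gamma i t) * lambda i * mu i +
    (1 - gamma i t) * delta * eps i w) ^+ 2)%:E)%E.
  apply: eq_integral => w _; congr EFin; apply: eq_bigr => i _.
  by rewrite /Y /observation; ring.
rewrite integral_sum_gauss_sqr//; congr EFin; apply: eq_bigr => i _; ring.
Qed.

Lemma lambda_neq0 i : lambda i != 0.
Proof. by rewrite gt_eqF//; case/andP: (lambda01 i). Qed.

Lemma enorm_estimator t w :
  enorm (fun i => estimator gamma lambda t (Y w) i - mu i) ^+ 2 =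
  \sum_i (- (1 - gamma i t) * mu i + delta * gamma i t / lambda i * eps i w) ^+ 2.
Proof.
rewrite /enorm sqr_sqrtr; last by apply: sumr_ge0 => i _; exact: sqr_ge0.
apply: eq_bigr => i _; congr (_ ^+ 2).
by rewrite /estimator /Y /observation; field; exact: lambda_neq0.
Qed.

Lemma mean_sq_error_estimator t :
  mean_sq_error P mu (fun w => estimator gamma lambda t (Y w)) =
  (strong_bias2 t + var delta gamma lambda t)%:E.
Proof.
rewrite /mean_sq_error unlock.
under eq_integral do rewrite enorm_estimator.
rewrite integral_sum_gauss_sqr//; congr EFin.
rewrite /strong_bias2 /var mulr_sumr -big_split/=; apply: eq_bigr => i _.
by field; exact: lambda_neq0.
Qed.

(** Coordinatewise [(p + q) ^+ 2 <= 2 * p ^+ 2 + 2 * q ^+ 2]. Being pathwise, the bound also applies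
    at a random time, where the cross term may have nonzero mean. *)
Lemma enorm_estimator_le t w :
  enorm (fun i => estimator gamma lambda t (Y w) i - mu i) ^+ 2 <=
  2 * strong_bias2 t + 2 * noise2 t w.
Proof.
rewrite enorm_estimator /strong_bias2 /noise2 !mulr_sumr -big_split/=.
apply: ler_sum => i _; set x := 1 - _.
have -> : delta ^+ 2 * (gamma i t ^+ 2 * lambda i ^- 2) * eps i w ^+ 2 =
  (delta * gamma i t / lambda i * eps i w) ^+ 2 by field; exact: lambda_neq0.
set y := delta * _ / _ * _.
by have := sqr_ge0 (x * mu i + y); nra.
Qed.

Lemma residual_weight01 t : 0 <= t -> forall i, 0 <= (1 - gamma i t) ^+ 2 <= 1.
Proof.
move=> t0 i; have /andP[? ?] := filter_itv filt i t0.
by rewrite sqr_ge0/=; nra.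
Qed.

(** Recentring from the mean residual to [c] only contributes a deterministic factor; the rest is
    the quadratic form with weights [(1 - gamma i t) ^+ 2]. *)
Lemma mean_le_exp_residual x c t : 0 <= t -> `|x| <= 4^-1 ->
  mean_le P (fun w => expR (x * (residual2 gamma t (Y w) - c) / delta ^+ 2))
    (expR (x * (mean_residual2 t - c) / delta ^+ 2 +
           4 * x ^+ 2 * (D%:R + weak_bias2 gamma lambda mu t / delta ^+ 2))).
Proof.
move=> t0 x4; set k := x * (mean_residual2 t - c) / delta ^+ 2.
have d0 : delta != 0 by rewrite gt_eqF.
have -> : (fun w => expR (x * (residual2 gamma t (Y w) - c) / delta ^+ 2)) =
    (fun w => expR k * expR (x * \sum_i (1 - gamma i t) ^+ 2 *
                              ((a i + eps i w) ^+ 2 - a i ^+ 2 - 1))).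
  apply/funext => w; rewrite -expRD; congr expR;
      rewrite /k residual2E mean_residual2E.
  have -> : \sum_i (1 - gamma i t) ^+ 2 * ((a i + eps i w) ^+ 2 - a i ^+ 2 - 1) =
     \sum_i (1 - gamma i t) ^+ 2 * (a i + eps i w) ^+ 2
     - \sum_i (1 - gamma i t) ^+ 2 * (a i ^+ 2 + 1).
    by rewrite -sumrB; apply: eq_bigr => i _; ring.
  by field.
rewrite expRD; apply: mean_leZ; first exact: expR_ge0.
have -> : weak_bias2 gamma lambda mu t / delta ^+ 2 =
    \sum_i (1 - gamma i t) ^+ 2 * a i ^+ 2.
  by rewrite weak_bias2E; field.
exact: mean_le_exp_quadratic (residual_weight01 t0).
Qed.

Lemma noise2_ge0 t w : 0 <= noise2 t w.
Proof.
apply: sumr_ge0 => i _; rewrite mulr_ge0 ?sqr_ge0// mulr_ge0 ?sqr_ge0//.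
by rewrite mulr_ge0 ?sqr_ge0// invr_ge0 sqr_ge0.
Qed.

Lemma measurable_noise2 t : measurable_fun setT (noise2 t).
Proof.
apply: measurable_sum => i; apply: measurable_funM => //.
by apply: measurable_funX; exact: measurable_funPT.
Qed.

Lemma mean_le_noise2 t : mean_le P (noise2 t) (var delta gamma lambda t).
Proof.
split; [exact: measurable_noise2|exact: noise2_ge0|].
have -> : (\int[P]_w (noise2 t w)%:E = \int[P]_w
    (\sum_i (0 + delta * gamma i t / lambda i * eps i w) ^+ 2)%:E)%E.
  apply: eq_integral => w _; congr EFin; apply: eq_bigr => i _.
  by field; exact: lambda_neq0.
rewrite integral_sum_gauss_sqr// lee_fin /var mulr_sumr.
rewrite le_eqVlt; apply/orP; left; apply/eqP; apply: eq_bigr => i _.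
by field; exact: lambda_neq0.
Qed.

Lemma mean_le_noise2_sqr t :
  mean_le P (fun w => noise2 t w ^+ 2)
    (64 * expR 1 * var delta gamma lambda t ^+ 2).
Proof.
rewrite /var mulr_sumr; apply: mean_le_sqr_weighted_chi2 => // i.
by rewrite mulr_ge0 ?sqr_ge0// mulr_ge0 ?sqr_ge0// invr_ge0 sqr_ge0.
Qed.

Lemma noise2_le s t c w : (forall i, 0 <= gamma i s <= c * gamma i t) ->
  noise2 s w <= c ^+ 2 * noise2 t w.
Proof.
move=> st; rewrite /noise2 mulr_sumr; apply: ler_sum => i _.
have /andP[s0 sc] := st i.
have gg : gamma i s ^+ 2 <= c ^+ 2 * gamma i t ^+ 2.
  by rewrite -exprMn ler_pXn2r// nnegrE//; exact: le_trans sc.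
set z := delta ^+ 2 * lambda i ^- 2 * eps i w ^+ 2.
have z0 : 0 <= z by rewrite mulr_ge0 ?sqr_ge0// mulr_ge0 ?sqr_ge0// invr_ge0
    sqr_ge0.
have -> u : delta ^+ 2 * (u * lambda i ^- 2) * eps i w ^+ 2 = u * z
    by rewrite /z; ring.
rewrite (_ : delta ^+ 2 * _ * _ = gamma i t ^+ 2 * z); last by rewrite /z; ring.
by rewrite mulrA; exact: ler_wpM2r.
Qed.

Local Notation wbias := (weak_bias2 gamma lambda mu).
Local Notation v t := (\sum_i gamma i t ^+ 2).

Lemma strong_bias2_ge0 t : 0 <= strong_bias2 t.
Proof. by apply: sumr_ge0 => i _; rewrite mulr_ge0 ?sqr_ge0. Qed.

Lemma strong_bias2_le s t : 0 <= s -> s <= t -> strong_bias2 t <= strong_bias2 s.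
Proof. by move=> s0 st; apply: filter_residual_le => // i; rewrite sqr_ge0. Qed.

Let weak_bias2_resE t : wbias t =
  \sum_i (1 - gamma i t) ^+ 2 * (lambda i ^+ 2 * mu i ^+ 2).
Proof. by rewrite /weak_bias2; apply: eq_bigr => i _; rewrite -mulrA. Qed.

Lemma weak_bias2_le s t : 0 <= s -> s <= t -> wbias t <= wbias s.
Proof.
move=> s0 st; rewrite !weak_bias2_resE; apply: filter_residual_le => // i.
by rewrite mulr_ge0 ?sqr_ge0.
Qed.

Lemma continuous_weak_bias2 : {within `[0, +oo[, continuous wbias}.
Proof. by rewrite (funext weak_bias2_resE); exact: continuous_filter_residual. Qed.

(** For [p >= q >= 0], [p ^+ 2 - q ^+ 2 >= (p - q) ^+ 2], applied to the noise part of the mean. The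
    bias drop serves the lower tail, the filter increment the upper one. *)
Lemma mean_residual2_drop s t : 0 <= s -> s <= t ->
  mean_residual2 t + (wbias s - wbias t)
    + delta ^+ 2 * \sum_i (gamma i t - gamma i s) ^+ 2 <= mean_residual2 s.
Proof.
move=> s0 st; have t0 := le_trans s0 st.
rewrite /mean_residual2 /weak_bias2 mulr_sumr -sumrB -!big_split/=.
apply: ler_sum => i _; rewrite -subr_ge0.
have /andP[_] := filter_itv filt i t0; have := filter_le filt i s0 st.
set x := gamma i s; set y := gamma i t => xy y1.
rewrite (_ : _ - _ = delta ^+ 2 * (2 * (y - x) * (1 - y))); last by ring.
by rewrite mulr_ge0 ?sqr_ge0// mulr_ge0 ?subr_ge0// mulr_ge0// subr_ge0.
Qed.

(** * Residual tails and domination of the stopped bias *)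

Let sqrtD : R := Num.sqrt D%:R.
Let D_ge1 : 1 <= D%:R :> R. Proof. by rewrite ler1n. Qed.
Let sqrtD_ge1 : 1 <= sqrtD.
Proof. by rewrite /sqrtD -[X in X <= _]sqrtr1 ler_sqrt// ltr0n. Qed.
Let sqrtD2 : sqrtD ^+ 2 = D%:R. Proof. by rewrite sqr_sqrtr// ler0n. Qed.
Let sqrtD_gt0 : 0 < sqrtD. Proof. exact: lt_le_trans ltr01 sqrtD_ge1. Qed.
Let delta2 : 0 < delta ^+ 2. Proof. exact: exprn_gt0. Qed.

(** The linear term of the exponent is at most [- eta * N]. In [eta^-1], the part
    [8 * (C1 ^- 2 + 2 / C1)] limits the quadratic term to half of that, and [4 / C1] keeps the scale
    [x] below 1/4. *)
Lemma lower_tail (C1 t bs kappa N : R) :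
  0 < C1 -> 1 <= N -> 0 <= t -> C1 * sqrtD * delta ^+ 2 <= bs ->
  wbias t = (N + 1) * bs -> kappa + N * bs <= mean_residual2 t ->
  let eta := (8 * (C1 ^- 2 + 2 / C1) + 4 / C1)^-1 in
  mean_le P (fun w => expR (- (eta * delta ^+ 2 / bs) *
                (residual2 gamma t (Y w) - kappa) / delta ^+ 2))
    (expR (- (eta / 2) * N)).
Proof.
move=> C10 N1 t0 bsD bt mt eta.
set beta := bs / delta ^+ 2.
have bE : bs = beta * delta ^+ 2 by rewrite /beta divfK// gt_eqF.
have betaD : C1 * sqrtD <= beta by rewrite /beta ler_pdivlMr.
have beta0 : 0 < beta by apply: lt_le_trans betaD; rewrite mulr_gt0.
have betaC : C1 <= beta by apply: le_trans betaD; rewrite ler_peMr// ltW.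
have i0 : 0 < C1^-1 by rewrite invr_gt0.
have i20 : 0 < C1 ^- 2 by rewrite invr_gt0 exprn_gt0.
have den0 : 0 < 8 * (C1 ^- 2 + 2 / C1) + 4 / C1 by lra.
have eta0 : 0 < eta by rewrite invr_gt0.
have etaE : eta * (8 * (C1 ^- 2 + 2 / C1) + 4 / C1) = 1.
  by rewrite /eta mulVf// gt_eqF.
have ib : 0 < beta^-1 <= C1^-1.
  by rewrite invr_gt0 beta0/= lef_pV2 ?posrE.
set x := eta / beta.
have xE : eta * delta ^+ 2 / bs = x.
  by rewrite bE /x; field; rewrite !gt_eqF.
have x0 : 0 < x by rewrite divr_gt0.
have x4 : x <= 4^-1.
  have : x <= eta / C1 by rewrite ler_pM2l//; case/andP: ib.
  by have := mulr_gt0 eta0 i20; have := mulr_gt0 eta0 i0; move: etaE; lra.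
rewrite xE; have := @mean_le_exp_residual (- x) kappa t t0.
rewrite normrN ger0_norm ?(ltW x0)// => /(_ x4) /mean_le_trans; apply.
rewrite ler_expR sqrrN bt bE.
have h1 : - x * (mean_residual2 t - kappa) / delta ^+ 2 <= - (eta * N).
  rewrite ler_pdivrMr// mulNr mulNr lerN2.
  have -> : eta * N * delta ^+ 2 = x * (N * bs).
    by rewrite bE /x; field; rewrite gt_eqF.
  by rewrite ler_pM2l//; lra.
have -> : (N + 1) * (beta * delta ^+ 2) / delta ^+ 2 = (N + 1) * beta.
  by field; rewrite gt_eqF.
have h2 : 4 * x ^+ 2 * (D%:R + (N + 1) * beta) <=
    4 * eta ^+ 2 * (N * (C1 ^- 2 + 2 / C1)).
  have -> : 4 * x ^+ 2 * (D%:R + (N + 1) * beta) =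
      4 * eta ^+ 2 * (D%:R / beta ^+ 2 + (N + 1) / beta).
    by rewrite /x; field; rewrite gt_eqF.
  apply: ler_wpM2l; first by rewrite mulr_ge0 ?sqr_ge0.
  have Db : D%:R / beta ^+ 2 <= C1 ^- 2.
    rewrite ler_pdivrMr ?exprn_gt0// mulrC ler_pdivlMr ?exprn_gt0//.
    rewrite -sqrtD2 -exprMn mulrC ler_pXn2r// nnegrE; [|exact: ltW].
    by rewrite mulr_ge0// ltW.
  have Nb : (N + 1) / beta <= (2 * N) / C1.
    have /andP[? ?] := ib; by apply: ler_pM; [lra|exact: ltW|lra|].
  have NC : C1 ^- 2 <= N * C1 ^- 2 by rewrite ler_peMl// ltW.
  by rewrite mulrDr; lra.
have h3 : 8 * eta * (C1 ^- 2 + 2 / C1) <= 1.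
  by have := mulr_gt0 eta0 i0; move: etaE; lra.
have h4 : 4 * eta ^+ 2 * (N * (C1 ^- 2 + 2 / C1)) =
   (eta * N / 2) * (8 * eta * (C1 ^- 2 + 2 / C1)) by field; rewrite gt_eqF.
have eN : 0 <= eta * N / 2 by rewrite divr_ge0// mulr_ge0 ?ltW//; lra.
have := ler_wpM2l eN h3; rewrite -h4 mulr1; move: h1 h2; lra.
Qed.

(** At scale [x = (4 * sqrtD)^-1] the quadratic term stays below [(1 + C2) / 4] whatever [D] is,
    while the gap to [kappa] contributes [- K / 16]. *)
Lemma upper_tail (C2 t kappa K : R) :
  0 <= C2 -> 0 <= t -> wbias t <= C2 * D%:R * delta ^+ 2 ->
  mean_residual2 t + delta ^+ 2 * (K * sqrtD / 4) <= kappa ->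
  mean_le P (fun w => expR ((4 * sqrtD)^-1 * (residual2 gamma t (Y w) - kappa)
                             / delta ^+ 2))
    (expR ((1 + C2) / 4 - K / 16)).
Proof.
move=> C20 t0 bt mt; set x := (4 * sqrtD)^-1.
have s0 := sqrtD_gt0; have s1 := sqrtD_ge1.
have x0 : 0 < x by rewrite invr_gt0; lra.
have x4 : x <= 4^-1 by rewrite lef_pV2 ?posrE//; lra.
have := @mean_le_exp_residual x kappa t t0.
rewrite ger0_norm ?(ltW x0)// => /(_ x4) /mean_le_trans; apply.
rewrite ler_expR.
have h1 : x * (mean_residual2 t - kappa) / delta ^+ 2 <= - (K / 16).
  rewrite ler_pdivrMr//.
  have -> : - (K / 16) * delta ^+ 2 = x * - (delta ^+ 2 * (K * sqrtD / 4)).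
    by rewrite /x; field; rewrite gt_eqF.
  by rewrite ler_pM2l//; lra.
have h2 : 4 * x ^+ 2 * (D%:R + wbias t / delta ^+ 2) <= (1 + C2) / 4.
  have -> : (1 + C2) / 4 = 4 * x ^+ 2 * (D%:R + C2 * D%:R).
    by rewrite -sqrtD2 /x; field; rewrite gt_eqF.
  apply: ler_wpM2l; first by rewrite mulr_ge0// sqr_ge0.
  by rewrite lerD2l ler_pdivrMr.
by lra.
Qed.

(** Stopping after [ts] only lowers the bias. Before [ts], the strong bias ratio is at most the weak
    one, which is bounded by a constant plus exponential weights whose means form a geometric
    series. *)
Lemma bias_dominated (C1 t0 ts kappa : R) (tau : T -> R) :
  0 < C1 -> 0 <= t0 -> t0 <= ts ->
  (t0 < ts -> C1 * sqrtD * delta ^+ 2 <= wbias ts) ->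
  (t0 < ts -> kappa <= mean_residual2 ts) ->
  (forall w, t0 <= tau w) ->
  (forall w t, t0 <= t -> tau w < t -> residual2 gamma t (Y w) <= kappa) ->
  (forall i j : 'I_D, (i <= j)%N -> lambda j <= lambda i) ->
  (forall t, t0 <= t -> t <= ts -> forall i j : 'I_D, (i <= j)%N ->
    (1 - gamma j t) ^+ 2 * (1 - gamma i ts) ^+ 2 <=
    (1 - gamma i t) ^+ 2 * (1 - gamma j ts) ^+ 2) ->
  let eta := (8 * (C1 ^- 2 + 2 / C1) + 4 / C1)^-1 in
  exists2 F, (forall w, strong_bias2 (tau w) <= F w) &
    mean_le P F ((3 + (1 - expR (- (eta / 2)))^-1) * strong_bias2 ts).
Proof.
move=> C10 t00 t0ts bsD kts t0tau restau lmon cross eta.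
have ts0 := le_trans t00 t0ts.
have sb0 := strong_bias2_ge0 ts.
have eta0 : 0 < eta / 2.
  have i0 : 0 < C1^-1 by rewrite invr_gt0.
  have i20 : 0 < C1 ^- 2 by rewrite invr_gt0 exprn_gt0.
  by rewrite divr_gt0// invr_gt0; lra.
have g0 : 0 < (1 - expR (- (eta / 2)))^-1.
  by rewrite invr_gt0 subr_gt0 expR_lt1 oppr_lt0.
have [tst0|ltts] := leP ts t0.
  exists (fun=> strong_bias2 ts) => [w|].
    by apply: strong_bias2_le => //; exact: le_trans (t0tau w).
  apply: mean_le_trans (mean_le_cst P sb0) _.
  by rewrite ler_peMl//; lra.
set bs := wbias ts.
have bs0 : 0 < bs by apply: lt_le_trans (bsD ltts); rewrite !mulr_gt0.
(* [U n] is an exponential weight on the event that stopping happens before the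
   time at which the weak bias equals n + 2 times its value at [ts]. *)
have /choice[U HU] (n : nat) : exists U : T -> R,
    mean_le P U (expR (- (eta / 2) * n.+1%:R)) /\
    forall w, (n%:R + 2) * bs < wbias (tau w) -> 1 <= U w.
  (* If the level is not exceeded at [t0], it is never exceeded later, and the zero weight
     suffices. *)
  have [small|large] := leP (wbias t0) ((n%:R + 2) * bs).
    exists (fun=> 0); split=> [|w].
      by apply: mean_le_trans (mean_le_cst P (lexx 0)) _; exact: expR_ge0.
    by have := weak_bias2_le t00 (t0tau w); lra.
  have [|t /andP[t0t tts] bt] := ivt_nonneg t00 t0ts continuous_weak_bias2
      (c := (n%:R + 2) * bs).
    rewrite ge_min le_max (ltW large)/= andbT; apply/orP; right.
    by rewrite ler_peMl ?(ltW bs0)//; have := ler0n R n; lra.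
  have t_0 := le_trans t00 t0t.
  (* The level [n + 2] is [N + 1] with [N = n + 1]. *)
  have := @lower_tail C1 t bs kappa n.+1%:R C10.
  rewrite ler1n => /(_ isT t_0 (bsD ltts)); rewrite bt -natr1 => tail.
  exists (fun w => expR (- (eta * delta ^+ 2 / bs) *
    (residual2 gamma t (Y w) - kappa) / delta ^+ 2)); split=> [|w btau].
    apply: tail; first by congr (_ * _); ring.
    have := mean_residual2_drop t_0 tts; have := kts ltts; rewrite bt -/bs.
    have : 0 <= delta ^+ 2 * \sum_i (gamma i ts - gamma i t) ^+ 2.
      by rewrite mulr_ge0 ?sqr_ge0// sumr_ge0// => i _; exact: sqr_ge0.
    by lra.
  (* Stopping before [t] means that the residual at [t] is at most [kappa], so the exponent is
     nonnegative. *)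
  apply: le_trans (expR_ge1Dx _); rewrite lerDl.
  have taut : tau w < t.
    rewrite ltNge; apply/negP => ttau.
    by have := weak_bias2_le t_0 ttau; rewrite bt; lra.
  rewrite divr_ge0 ?sqr_ge0// mulNr oppr_ge0 mulr_ge0_le0//; last first.
    by have := restau w t t0t taut; lra.
  rewrite divr_ge0 ?(ltW bs0)// mulr_ge0 ?sqr_ge0//.
  by have := eta0; lra.
have U0 n w : 0 <= U n w by have [[]] := HU n.
(* The weak bias at [t0] caps the ratio deterministically, so finitely many levels suffice; the
   geometric bound is uniform in [N]. *)
have [N bN] : exists N, wbias t0 / bs <= N%:R + 2.
  exists (Num.truncn (wbias t0 / bs)).+1.
  by have := truncnS_gt (wbias t0 / bs); lra.
exists (fun w => strong_bias2 ts * (3 + \sum_(n < N) U n w)) => [w|].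
  have SU : 0 <= \sum_(n < N) U n w by exact: sumr_ge0.
  have [tstau|tauts] := leP ts (tau w).
    apply: le_trans (strong_bias2_le ts0 tstau) _.
    by rewrite ler_peMr//; lra.
  have assoc : strong_bias2 (tau w) * bs <= wbias (tau w) * strong_bias2 ts.
    apply: (@association_ineq _ _ (fun i => (1 - gamma i (tau w)) ^+ 2)
      (fun i => (1 - gamma i ts) ^+ 2) (fun i => lambda i ^+ 2)
      (fun i => mu i ^+ 2)).
    - by move=> i; exact: sqr_ge0.
    - move=> i j ij; have /andP[lj _] := lambda01 j.
      by rewrite ler_pXn2r ?nnegrE ?(ltW lj) ?lmon// (le_trans (ltW lj)) ?lmon.
    - by apply: cross => //; exact: ltW.
  rewrite -ler_pdivlMr// in assoc; apply: le_trans assoc _.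
  rewrite mulrAC [X in _ <= X]mulrC; apply: ler_wpM2r => //.
  have : wbias (tau w) / bs <= 2 + \sum_(n < N) U n w.
    apply: (le_sum_thresholds (u := fun n => U n w)) => // [|n].
      apply: le_trans bN; rewrite ler_pM2r ?invr_gt0//.
      exact: weak_bias2_le.
    by rewrite ltr_pdivlMr//; have [_] := HU n; apply.
  by lra.
have three : 0 <= 3 :> R by [].
have := mean_leZ sb0 (mean_leD (mean_le_cst P three)
  (@mean_le_sum _ _ _ P _ (index_enum 'I_N) (fun (n : 'I_N) w => U n w)
     (fun n : 'I_N => expR (- (eta / 2) * n.+1%:R)) (fun n : 'I_N => (HU n).1))).
move=> /mean_le_trans; apply; rewrite mulrC; apply: ler_wpM2r => //.
rewrite lerD2l; apply: le_trans (sum_expR_le N eta0).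
by apply: ler_sum => n _; rewrite ler_expR !mulNr lerN2 ler_pM2l// ler_nat.
Qed.

(** * Domination of the stopped noise *)

Lemma var_gt0 t : 0 < v t -> 0 < var delta gamma lambda t.
Proof.
move=> vt; apply: (@lt_le_trans _ _ (delta ^+ 2 * v t)); first exact: mulr_gt0.
rewrite ler_pM2l//; apply: ler_sum => i _; rewrite ler_peMr ?sqr_ge0//.
have /andP[l0 l1] := lambda01 i.
by rewrite invf_ge1 ?exprn_gt0// expr_le1// ltW.
Qed.

(** The noise at [tau] is compared with that at deterministic times [s n], multiplied by weights for
    late stopping. The polynomial growth of the variance is absorbed by the exponential decay of the
    weights. *)
Lemma noise_dominated (C2 CV A ppi ts kappa : R) (tau : T -> R) :
  0 <= C2 -> 0 <= CV -> 0 <= ppi -> 0 <= A ->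
  (forall x, 1 <= x -> x `^ ppi <= A * expR (128^-1 * x)) ->
  0 <= ts -> sqrtD <= v ts ->
  wbias ts <= C2 * D%:R * delta ^+ 2 -> mean_residual2 ts <= kappa ->
  (forall w, 0 <= tau w) ->
  (forall w t, ts <= t -> t < tau w -> kappa < residual2 gamma t (Y w)) ->
  (forall t, ts <= t -> var delta gamma lambda t <=
     CV * (v t / v ts) `^ ppi * var delta gamma lambda ts) ->
  exists2 G, (forall w, noise2 (tau w) w <= G w) &
    mean_le P G ((1 + 4 * CV * 4 `^ ppi
      + 2 * (64 * expR 1 * CV ^+ 2 * A ^+ 2 + expR ((1 + C2) / 4))
          * (1 - expR (- 64^-1))^-1) * var delta gamma lambda ts).
Proof.
move=> C20 CV0 ppi0 A0 Apow ts0 Dvs bD ms tau0 restau Vgrowth.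
set Vs := var delta gamma lambda ts.
have vs0 : 0 < v ts by exact: lt_le_trans Dvs.
have Vs0 : 0 < Vs by exact: var_gt0.
have n4 n : 1 <= n%:R + 4 :> R by have := ler0n R n; lra.
have /choice[s Hs] (n : nat) : exists s : R, [/\ ts <= s, v s <= (n%:R + 4) * v ts &
    forall t, ts <= t -> v t <= (n%:R + 4) * v ts ->
        forall i, gamma i t <= 2 * gamma i s].
  by have [s [? ?] ?] := filter_level filt ts0 (n4 n); exists s.
have Vsn n : var delta gamma lambda (s n) <= CV * (n%:R + 4) `^ ppi * Vs.
  have [tss vs _] := Hs n; apply: le_trans (Vgrowth _ tss) _.
  rewrite ler_pM2r//; apply: ler_wpM2l => //.
  apply: ge0_ler_powR => //; rewrite ?nnegrE.
  - by rewrite divr_ge0 ?(ltW vs0)// sumr_ge0// => i _; exact: sqr_ge0.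
  - exact: le_trans (n4 n).
  - by rewrite ler_pdivrMr.
have noise_s n w : ts <= tau w -> v (tau w) <= (n%:R + 4) * v ts ->
    noise2 (tau w) w <= 4 * noise2 (s n) w.
  move=> tstau vtau; have [_ _ /(_ _ tstau vtau) gs] := Hs n.
  have -> : 4 = 2 ^+ 2 :> R by ring.
  apply: noise2_le => i; rewrite gs andbT.
  by have /andP[] := filter_itv filt i (le_trans ts0 tstau).
(* [U n] is an exponential weight on the event that stopping happens after the
   time at which the weak variance equals n + 4 times its value at [ts]; no such
   time exists once this multiple reaches the total D. *)
have /choice[U HU] (n : nat) : exists U : T -> R,
  [/\ measurable_fun setT U, forall w, 0 <= U w,
    mean_le P (fun w => U w ^+ 2) (expR ((1 + C2) / 4 - (n%:R + 4) / 16)) &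
    forall w, ts <= tau w -> (n%:R + 4) * v ts < v (tau w) -> 1 <= U w].
  have [DK|KD] := leP D%:R ((n%:R + 4) * v ts).
    exists (fun=> 0); split => // [|w tstau].
      rewrite expr0n/=.
      by apply: mean_le_trans (mean_le_cst P (lexx 0)) _; exact: expR_ge0.
    by have := filter_sqr_le_dim filt (le_trans ts0 tstau); lra.
  have tsK : v ts <= (n%:R + 4) * v ts by rewrite ler_peMl// ltW.
  have [t tst vt] := filter_sqr_reach filt ts0 tsK KD.
  have t0 := le_trans ts0 tst.
  have x4 : `|(8 * sqrtD)^-1| <= 4^-1.
    have := sqrtD_ge1 => ?.
    by rewrite ger0_norm ?invr_ge0 ?lef_pV2 ?posrE//; lra.
  (* Half the scale of [upper_tail], so that the square of this weight has the bounded mean. *)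
  exists (fun w => expR ((8 * sqrtD)^-1 * (residual2 gamma t (Y w) - kappa) /
      delta ^+ 2)).
  split.
  - by have [] := mean_le_exp_residual kappa t0 x4.
  - by move=> w; exact: expR_ge0.
  - have drop := mean_residual2_drop ts0 tst.
    have bts := weak_bias2_le ts0 tst.
    (* With [K = n + 4], the increment is at least [(K / 2 - 1) * v ts]. This exceeds [K / 4 * v ts]
       exactly when [K >= 4], hence the first level 4. *)
    have dist : (n%:R + 4) * sqrtD / 4 <= \sum_i (gamma i t - gamma i ts) ^+ 2.
      have : v t <= 2 * \sum_i (gamma i t - gamma i ts) ^+ 2 + 2 * v ts.
        rewrite !mulr_sumr -big_split/=; apply: ler_sum => i _.
        by have := sqr_ge0 (gamma i t - 2 * gamma i ts); nra.
      have := ler_wpM2l (le_trans ler01 (n4 n)) Dvs.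
      have : 0 <= n%:R * v ts by rewrite mulr_ge0// ltW.
      by rewrite vt; lra.
    have mt : mean_residual2 t + delta ^+ 2 * ((n%:R + 4) * sqrtD / 4) <= kappa.
      by have := ler_wpM2l (ltW delta2) dist; lra.
    have := upper_tail C20 t0 (le_trans bts bD) mt.
    congr mean_le; apply/funext => w; rewrite -expRM_natl; congr expR.
    by field; rewrite !gt_eqF.
  - move=> w tstau vtau; apply: le_trans (expR_ge1Dx _); rewrite lerDl.
    have ttau : t < tau w.
      rewrite ltNge; apply/negP => taut.
      by have := filter_sqr_le filt (tau0 w) taut; rewrite vt; lra.
    have := restau w t tst ttau => ?.
    by rewrite divr_ge0 ?sqr_ge0// mulr_ge0 ?invr_ge0 ?mulr_ge0 ?(ltW
        sqrtD_gt0)//; lra.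
(* The terms cover [tau w <= ts], a variance ratio up to 4, and a ratio between [n + 4] and [n + 5]:
   there [s n.+1] supplies the upper end and [U n] the lower. The factor 4 is the square of the 2 in
   [filter_level]. *)
exists (fun w => noise2 ts w + (4 * noise2 (s 0%N) w +
    \sum_(n < D) 4 * (noise2 (s n.+1) w * U n w))) => [w|].
  have U0 n : 0 <= U n w by have [] := HU n.
  have SU0 n : 0 <= 4 * (noise2 (s n.+1) w * U n w).
    by rewrite mulr_ge0// mulr_ge0// noise2_ge0.
  have sum0 : 0 <= \sum_(n < D) 4 * (noise2 (s n.+1) w * U n w) by exact: sumr_ge0.
  have := noise2_ge0 ts w; have := noise2_ge0 (s 0%N) w => ? ?.
  have [tauts|/ltW tstau] := leP (tau w) ts.
    have : noise2 (tau w) w <= 1 ^+ 2 * noise2 ts w.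
      apply: noise2_le => i; rewrite mul1r (filter_le filt)// andbT.
      by have /andP[] := filter_itv filt i (tau0 w).
    by rewrite expr1n; lra.
  have xD : v (tau w) / v ts <= D%:R + 4.
    rewrite ler_pdivrMr//; apply: le_trans (filter_sqr_le_dim filt (tau0 w)) _.
    have := D_ge1; have := le_trans sqrtD_ge1 Dvs => ? ?.
    by nra.
  have [x4|[n nD /andP[nx xn]]] := threshold_bracket xD.
    have := noise_s 0%N w tstau.
    by rewrite ler_pdivrMr// in x4; rewrite add0r => /(_ x4); lra.
  rewrite ltr_pdivlMr// in nx; rewrite ler_pdivrMr// in xn.
  have Un : 1 <= U n w by have [_ _ _] := HU n; apply.
  have Sn : noise2 (tau w) w <= 4 * noise2 (s n.+1) w.
    by apply: noise_s => //; apply: le_trans xn _; rewrite -natr1 ler_pM2r//; lra.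
  have : 4 * noise2 (s n.+1) w <= 4 * (noise2 (s n.+1) w * U n w).
    by rewrite ler_pM2l// ler_peMr// noise2_ge0.
  rewrite (bigD1 (Ordinal nD))//=.
  have : 0 <= \sum_(i < D | i != Ordinal nD) 4 * (noise2 (s i.+1) w * U i w).
    exact: sumr_ge0.
  by lra.
have SUn n : mean_le P (fun w => 4 * (noise2 (s n.+1) w * U n w))
    (2 * (64 * expR 1 * CV ^+ 2 * A ^+ 2 + expR ((1 + C2) / 4)) * Vs
       * expR (- 64^-1 * n%:R)).
  have [mU U0 U2 _] := HU n.
  (* [e ^+ 2] is the decay of the mean of [U n ^+ 2]. The choice [r = e / Vs] leaves one factor
     [e * Vs] in each half of the decoupled bound. *)
  pose e : R := expR (- ((n%:R + 4) / 32)); have e0 : 0 < e := expR_gt0 _.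
  pose r := e / Vs; have r0 : 0 < r by rewrite divr_gt0.
  have a0 : 0 <= 2 * r by rewrite mulr_ge0// ltW.
  have b0 : 0 <= 2 * r^-1 by rewrite mulr_ge0// invr_ge0 ltW.
  (* 4 x y <= 2 (r x^2 + y^2 / r) decouples the noise from the weight. *)
  apply: mean_le_le (mean_le_trans
    (mean_leD (mean_leZ a0 (mean_le_noise2_sqr (s n.+1))) (mean_leZ b0 U2)) _).
  - apply: measurable_funM => //; apply: measurable_funM => //.
    exact: measurable_noise2.
  - by move=> w; rewrite mulr_ge0// mulr_ge0// noise2_ge0.
  - move=> w; rewrite -subr_ge0.
    set x := noise2 _ w; set y := U n w.
    have -> : 2 * r * x ^+ 2 + 2 * r^-1 * y ^+ 2 - 4 * (x * y) =
        2 * r * (x - y / r) ^+ 2.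
      by field; rewrite gt_eqF.
    by rewrite mulr_ge0 ?sqr_ge0.
  (* The left exponent is [- (n + 3) / 64]: half of the decay survives the growth of the squared
     variance. *)
  have en : e * expR (n.+1%:R / 64 + 4 / 64) <= expR (- 64^-1 * n%:R).
    by rewrite /e -expRD ler_expR -natr1; lra.
  have e2 : expR ((1 + C2) / 4 - (n%:R + 4) / 16) = expR ((1 + C2) / 4) * e ^+ 2.
    by rewrite /e -expRM_natl -expRD; congr expR; field.
  have en' : e <= expR (- 64^-1 * n%:R).
    by rewrite /e ler_expR; have := ler0n R n; lra.
  have -> : 2 * r^-1 * expR ((1 + C2) / 4 - (n%:R + 4) / 16)
      = 2 * expR ((1 + C2) / 4) * Vs * e.
    by rewrite e2 /r; field; rewrite !gt_eqF.
  have V2 : var delta gamma lambda (s n.+1) ^+ 2 <=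
      (CV * Vs) ^+ 2 * (A ^+ 2 * expR (n.+1%:R / 64 + 4 / 64)).
    have -> : A ^+ 2 * expR (n.+1%:R / 64 + 4 / 64) =
        (A * expR (128^-1 * (n.+1%:R + 4))) ^+ 2.
      by rewrite exprMn -expRM_natl; congr (_ * expR _); field.
    rewrite -exprMn ler_pXn2r ?nnegrE//; last 2 first.
    - apply: mulr_ge0; first exact: sqr_ge0.
      by apply: sumr_ge0 => i _; rewrite mulr_ge0 ?sqr_ge0// invr_ge0 sqr_ge0.
    - by apply: mulr_ge0; apply: mulr_ge0; rewrite ?expR_ge0 ?(ltW Vs0).
    apply: le_trans (Vsn _) _; rewrite mulrAC; apply: ler_wpM2l.
      by rewrite mulr_ge0// ltW.
    exact: Apow.
  have V3 : 2 * r * (64 * expR 1 * var delta gamma lambda (s n.+1) ^+ 2) <=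
      2 * (64 * expR 1 * CV ^+ 2 * A ^+ 2) * Vs * expR (- 64^-1 * n%:R).
    have c0 : 0 <= 2 * (64 * expR 1 * CV ^+ 2 * A ^+ 2) * Vs.
      rewrite mulr_ge0 ?(ltW Vs0)// mulr_ge0//.
      by rewrite mulr_ge0 ?sqr_ge0// mulr_ge0 ?sqr_ge0// mulr_ge0 ?expR_ge0.
    apply: le_trans (ler_wpM2l c0 en).
    have -> : 2 * (64 * expR 1 * CV ^+ 2 * A ^+ 2) * Vs *
        (e * expR (n.+1%:R / 64 + 4 / 64))
      = 2 * r * (64 * expR 1) * ((CV * Vs) ^+ 2 *
          (A ^+ 2 * expR (n.+1%:R / 64 + 4 / 64))).
      by rewrite /r; field; rewrite gt_eqF.
    rewrite mulrA; apply: ler_wpM2l => //.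
    by rewrite mulr_ge0// mulr_ge0 ?expR_ge0.
  have c0 : 0 <= 2 * expR ((1 + C2) / 4) * Vs.
    by rewrite mulr_ge0 ?(ltW Vs0)// mulr_ge0 ?expR_ge0.
  by have := ler_wpM2l c0 en'; lra.
have := mean_leD (mean_le_noise2 ts) (mean_leD
  (mean_leZ (ler0n R 4) (mean_le_noise2 (s 0%N)))
  (@mean_le_sum _ _ _ P _ (index_enum 'I_D)
     (fun (n : 'I_D) w => 4 * (noise2 (s n.+1) w * U n w)) _
     (fun n : 'I_D => SUn n))).
move=> /mean_le_trans; apply.
rewrite -mulr_sumr; have := Vsn 0%N; rewrite add0r.
have i64 : 0 < 64^-1 :> R by [].
have := sum_expR_le D i64; set q := (1 - _)^-1; set S := \sum_(n < D) _ => Sq Vs4.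
set k := 2 * _.
have k0 : 0 <= k * Vs.
  rewrite mulr_ge0 ?(ltW Vs0)// mulr_ge0// addr_ge0 ?expR_ge0//.
  by rewrite mulr_ge0 ?sqr_ge0// mulr_ge0 ?sqr_ge0// mulr_ge0 ?expR_ge0.
by have := ler_wpM2l k0 Sq; rewrite -/Vs; lra.
Qed.

End early_stopping.

(** * Assembly of the risk bound *)

Theorem corollary2p9 (R : realType)
    (Ccirc C1 C2 clambda ppi CV nu_minus : R) (L : nat)
    (hCcirc : 1 <= Ccirc) (hC1 : 0 < C1) (hC2 : 0 < C2)
    (hclambda : 0 < clambda) (hppi : 1 <= ppi) (hCV : 1 <= CV)
    (hnu_minus : 0 < nu_minus) (hL : (2 <= L)%N) :
  exists C : R,
    forall (D : nat) (delta kappa nu_plus : R) (lambda mu : 'I_D -> R)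
      (gamma : 'I_D -> R -> R)
      (d : measure_display) (T : measurableType d) (P : probability T R)
      (eps : 'I_D -> {RV P >-> R}),
    let Y : T -> 'I_D -> R :=
      fun w => observation delta lambda mu (fun i => eps i w) in
    let t0 := tcirc delta gamma Ccirc in
    let ts := tstar P gamma t0 kappa Y in
    0 < delta ->
    (forall i, 0 < lambda i <= 1) ->
    (forall i j : 'I_D, (i <= j)%N -> lambda j <= lambda i) ->
    mutually_independent eps ->
    (forall i, standard_normal (eps i)) ->
    (forall i, is_filter (gamma i)) ->
    Ccirc < Num.sqrt D%:R ->
    0 < kappa ->
    (* (i) *)
    (forall t' t, t0 <= t' -> t' <= t ->
       forall i j : 'I_D, (i <= j)%N ->
       (filter_ratio (gamma j t') (gamma j t)
          <= filter_ratio (gamma i t') (gamma i t))%E) ->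
    (* (ii) *)
    (forall (i' i : 'I_D) t, (i' <= i)%N -> t0 <= t ->
       gamma i t <= gamma i' t) ->
    (* (iii) *)
    (forall t' t, t0 <= t' -> t' <= t ->
       var delta gamma lambda t <=
       CV * (weak_var delta gamma t / weak_var delta gamma t') `^ ppi
          * var delta gamma lambda t') ->
    (* (iv) *)
    (forall k : 'I_D,
       clambda ^+ 2 * lambda k ^- 2 <=
       k.+1%:R^-1 * \sum_(i < D | (i <= k)%N) lambda i ^- 2) ->
    0 < nu_plus ->
    (L <= D)%N ->
    (forall k j : 'I_D, (L <= k.+1)%N -> j.+1 = ceil_divn k.+1 L ->
       0 < L%:R `^ (- nu_minus^-1) <= lambda k / lambda j) ->
    (forall k j : 'I_D, (L <= k.+1)%N -> j.+1 = (k.+1 %/ L)%N ->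
       lambda k / lambda j <= L%:R `^ (- nu_plus^-1) < 1) ->
    C1 * (t0 < ts)%R%:R * weak_var delta gamma t0
      <= weak_bias2 gamma lambda mu ts
      <= C2 * sup [set weak_var delta gamma t | t in [set t | 0 < t]] ->
    (mean_sq_error P mu
       (fun w => estimator gamma lambda (tau gamma t0 kappa (Y w)) (Y w))
     <= C%:E * mean_sq_error P mu
       (fun w => estimator gamma lambda ts (Y w)))%E.
Proof.
have i128 : 0 < 128^-1 :> R by [].
have ppi0 : 0 < ppi by exact: lt_le_trans hppi.
(* The variance bound enters squared, so rate 1/128 becomes 1/64, half of the available decay rate
   1/32. *)
have [A A0 Apow] := powR_le_expR ppi0 i128.
pose Cbias : R := 3 + (1 - expR (- ((8 * (C1 ^- 2 + 2 / C1) + 4 / C1)^-1 / 2)))^-1.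
pose Cnoise : R := 1 + 4 * CV * 4 `^ ppi
  + 2 * (64 * expR 1 * CV ^+ 2 * A ^+ 2 + expR ((1 + C2) / 4))
      * (1 - expR (- 64^-1))^-1.
have i0 : 0 <= C1^-1 by rewrite invr_ge0 ltW.
have i20 : 0 <= C1 ^- 2 by rewrite invr_ge0 sqr_ge0.
have Cbias0 : 0 <= Cbias.
  rewrite addr_ge0// invr_ge0 subr_ge0 expR_le1 oppr_le0.
  by rewrite divr_ge0// invr_ge0; lra.
have CV0 : 0 <= CV by exact: le_trans hCV.
have Cnoise0 : 0 <= Cnoise.
  have g0 : 0 <= (1 - expR (- 64^-1))^-1 :> R.
    by rewrite invr_ge0 subr_ge0 expR_le1 oppr_le0.
  apply: addr_ge0.
    by rewrite addr_ge0// mulr_ge0 ?powR_ge0// mulr_ge0.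
  rewrite mulr_ge0// mulr_ge0// addr_ge0 ?expR_ge0//.
  by rewrite mulr_ge0 ?sqr_ge0// mulr_ge0 ?sqr_ge0// mulr_ge0 ?expR_ge0.
(* Each factor 2 comes from splitting the squared error into bias and noise. *)
exists (2 * Cbias + 2 * Cnoise).
move=> D delta kappa nu_plus lambda mu gamma d T P eps Y t0 ts delta0 lambda01 lmon
  indep normal filt CD kappa0 ratio _ growth _ _ _ _ _ /andP[bias_ge bias_le].
have D0 : (0 < D)%N.
  rewrite lt0n; apply/eqP => D0; move: CD; rewrite D0 sqrtr0; lra.
have D1 : 1 <= D%:R :> R by rewrite ler1n.
have delta2 : 0 < delta ^+ 2 by exact: exprn_gt0.
pose v t := \sum_i gamma i t ^+ 2.
set c := Ccirc * Num.sqrt D%:R.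
have sD1 : 1 <= Num.sqrt D%:R :> R by rewrite -[X in X <= _]sqrtr1 ler_sqrt// ltr0n.
have sD2 : Num.sqrt D%:R * Num.sqrt D%:R = D%:R :> R by rewrite -expr2 sqr_sqrtr.
have cD : c < D%:R by rewrite -sD2 ltr_pM2r//; lra.
have sDc : Num.sqrt D%:R <= c by rewrite ler_peMl//; lra.
have [t00 ct0] : 0 <= t0 /\ c <= v t0.
  have -> : t0 = inf [set t | 0 <= t /\ v t = c].
    rewrite /t0 /tcirc; congr inf; apply/seteqP; split => t [? vt]; split => //.
      by apply: (mulfI (lt0r_neq0 delta2));
          rewrite -/(weak_var delta gamma t) vt mulrC.
    by rewrite /weak_var -/(v t) vt mulrC.
  apply: inf_level.
  - exact: continuous_filter_sqr.
  - exact: filter_sqr_le.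
  - rewrite /v big1 => [|i _]; first by lra.
    by case: (filt i) => _ _ _ -> _; rewrite expr0n.
  - exact: filter_sqr_large.
pose k i := lambda i ^+ 2 * mu i ^+ 2 + delta ^+ 2.
have k_ge0 i : 0 <= k i by rewrite addr_ge0 ?sqr_ge0// mulr_ge0 ?sqr_ge0.
have meanR t : 'E_P[(fun w => residual2 gamma t (Y w))]%E
    = (mean_residual2 delta lambda mu gamma t)%:E.
  exact: expectation_residual2.
have [t0ts mts kts _] : [/\ t0 <= ts,
    mean_residual2 delta lambda mu gamma ts <= kappa,
    t0 < ts -> kappa <= mean_residual2 delta lambda mu gamma ts &
    forall t, t0 <= t -> t < ts -> kappa < mean_residual2 delta lambda mu gamma t].
  have -> : ts = inf [set t | t0 <= t /\
      mean_residual2 delta lambda mu gamma t <= kappa].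
    rewrite /ts /tstar; congr inf; apply/seteqP.
    by split => t /= [?]; rewrite meanR lee_fin.
  apply: inf_crossing => //.
  - exact: (continuous_filter_residual filt (k := k)).
  - by move=> s t; exact: (filter_residual_le filt (k := k)).
  - exact: (filter_residual_small filt t0 (k := k)).
have tauP w : [/\ t0 <= tau gamma t0 kappa (Y w),
    residual2 gamma (tau gamma t0 kappa (Y w)) (Y w) <= kappa,
    t0 < tau gamma t0 kappa (Y w) ->
      kappa <= residual2 gamma (tau gamma t0 kappa (Y w)) (Y w) &
    forall t, t0 <= t -> t < tau gamma t0 kappa (Y w) ->
        kappa < residual2 gamma t (Y w)].
  have Y0 i : 0 <= Y w i ^+ 2 by exact: sqr_ge0.
  apply: (inf_crossing (f := fun t => residual2 gamma t (Y w))) => //.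
  - exact: (continuous_filter_residual filt (k := fun i => Y w i ^+ 2)).
  - by move=> s t; exact: (filter_residual_le filt (k := fun i => Y w i ^+ 2)).
  - exact: (filter_residual_small filt t0 (k := fun i => Y w i ^+ 2)).
have ts0 := le_trans t00 t0ts.
have vts : Num.sqrt D%:R <= v ts.
  exact: le_trans sDc (le_trans ct0 (filter_sqr_le filt t00 t0ts)).
have vts0 : 0 < v ts by exact: lt_le_trans (lt_le_trans ltr01 sD1) vts.
(* The indicator is 1 here, and [Ccirc >= 1] makes the weak variance at [t0] at least [delta ^+ 2]
   times the square root of [D]. *)
have bias_ge' : t0 < ts ->
    C1 * Num.sqrt D%:R * delta ^+ 2 <= weak_bias2 gamma lambda mu ts.
  move=> ltts; move: bias_ge; rewrite ltts mulr1; apply: le_trans.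
  rewrite -mulrA ler_pM2l// mulrC /weak_var ler_pM2l//; exact: le_trans ct0.
(* Filters are at most 1, so the supremum of the weak variance is at most [D * delta ^+ 2]. *)
have bias_le' : weak_bias2 gamma lambda mu ts <= C2 * D%:R * delta ^+ 2.
  apply: le_trans bias_le _; rewrite -mulrA ler_pM2l// mulrC.
  apply: ge_sup => [|_ [t /ltW t_ge0 <-]];
      first by exists (weak_var delta gamma 1); exists 1 => //=.
  by rewrite ler_pM2l//; exact: filter_sqr_le_dim.
have le1 i t : 0 <= t -> gamma i t <= 1 by move=> /(filter_itv filt i) /andP[].
have [F tauF meanF] : exists2 F,
    forall w, strong_bias2 mu gamma (tau gamma t0 kappa (Y w)) <= F w &
    mean_le P F (Cbias * strong_bias2 mu gamma ts).
  apply: (bias_dominated (kappa := kappa) delta0 lambda01 indep normal filt D0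
      hC1 t00 t0ts) => //.
  - by move=> w; have [] := tauP w.
  - move=> w t t0t taut; have [t0tau le_kappa _ _] := tauP w.
    apply: le_trans le_kappa.
    apply: (filter_residual_le filt (k := fun i => Y w i ^+ 2)) (ltW taut) => //.
    + by move=> i; exact: sqr_ge0.
    + exact: le_trans t00 t0tau.
  - move=> t t0t tts i j ij.
    have t_0 := le_trans t00 t0t.
    by apply: filter_ratio_cross; rewrite ?le1//; exact: ratio.
have [G tauG meanG] : exists2 G,
    forall w, noise2 delta lambda gamma eps (tau gamma t0 kappa (Y w)) w <= G w &
    mean_le P G (Cnoise * var delta gamma lambda ts).
  apply: (noise_dominated delta0 lambda01 indep normal filt D0 (ltW hC2) _
    (ltW ppi0)
    A0 Apow ts0 vts bias_le' mts) => //.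
  - by move=> w; have [? _ _ _] := tauP w; exact: le_trans t00 _.
  - move=> w t tst; have [_ _ _] := tauP w; apply; exact: le_trans tst.
  - move=> t tst; have := growth _ _ t0ts tst; rewrite /weak_var.
    by rewrite -mulf_div divff ?mul1r// gt_eqF.
rewrite [in leRHS]mean_sq_error_estimator// -EFinM.
have [_ _ meanFG] := mean_leD (mean_leZ (ler0n R 2) meanF)
    (mean_leZ (ler0n R 2) meanG).
have lin : 2 * (Cbias * strong_bias2 mu gamma ts) +
    2 * (Cnoise * var delta gamma lambda ts) <=
    (2 * Cbias + 2 * Cnoise) * (strong_bias2 mu gamma ts +
      var delta gamma lambda ts).
  have sb0 : 0 <= strong_bias2 mu gamma ts by exact: strong_bias2_ge0.
  have V0 : 0 <= var delta gamma lambda ts.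
    by apply: mean_le_ge0; exact: mean_le_noise2.
  by have := mulr_ge0 Cbias0 V0; have := mulr_ge0 Cnoise0 sb0; lra.
rewrite -lee_fin in lin; apply: le_trans (le_trans meanFG lin).
(* The stopped error is dominated pathwise by [2 * F w + 2 * G w]. *)
rewrite /mean_sq_error unlock; apply: ge0_le_integralT => w; rewrite lee_fin.
  exact: sqr_ge0.
apply: le_trans (enorm_estimator_le delta mu gamma eps lambda01 _ w) _.
by have := tauF w; have := tauG w; lra.
Qed.
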